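(* Let $n,m$ be positive integers and let $\alpha_1,\dots,\alpha_n$ be the simple roots of type $A_n$. There exists a bijection $\omega_n:\mathcal{D}^m_n\to\mathcal{R}^m_n$ such that for every $i\in\{1,\dots,n\}$ and every $D\in\mathcal{D}^m_n$, the facet $D$ contains the negative simple root $-\alpha_i$ if and only if the hyperplane $H_{\alpha_i,m}$ is a separating wall of the region $\omega_n(D)$.
   Context: Type $A_n$: let $\varepsilon_1,\dots,\varepsilon_{n+1}$ be the standard basis of $\mathbb{R}^{n+1}$, $V=\{x\in\mathbb{R}^{n+1}:\sum x_i=0\}$ with the standard inner product $\langle\cdot,\cdot\rangle$. The positive roots are $\alpha_{ij}=\varepsilon_i-\varepsilon_{j+1}$ for $1\le i\le j\le n$, and the simple roots are $\alpha_i=\alpha_{ii}=\varepsilon_i-\varepsilon_{i+1}$. For a root $\alpha$ and $k\in\mathbb{Z}$ let $H_{\alpha,k}=\{v\in V:\langle v,\alpha\rangle=k\}$. The $m$-Catalan arrangement $\mathrm{Cat}^m(A_n)$ is the set of hyperplanes $H_{\alpha,k}$ with $\alpha$ a positive root and $0\le k\le m$; its regions are the connected components of the complement of the union of these hyperplanes in $V$. A region is dominant if it lies in the dominant chamber $\{v\in V:\langle v,\alpha\rangle\ge 0 \text{ for all positive roots }\alpha\}$. $\mathcal{R}^m_n$ denotes the set of dominant regions of $\mathrm{Cat}^m(A_n)$. A wall of a region $R$ is a hyperplane of the arrangement supporting a facet of $R$; it is a separating wall if $R$ and the origin lie in different open half-spaces determined by it. Facets of the $m$-generalized cluster complex $\Delta^m(A_n)$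 (Fomin–Reading), realized as dissections: let $P$ be a convex polygon with $m(n+1)+2$ vertices labeled $0,1,\dots,m(n+1)+1$ counterclockwise. An $m$-diagonal is a diagonal of $P$ dividing it into two polygons each of whose number of vertices is congruent to $2$ modulo $m$. An $m$-dissection is a set of $n$ pairwise non-crossing (in the interior) $m$-diagonals (equivalently a subdivision of $P$ into $(m+2)$-gons). $\mathcal{D}^m_n$ is the set of $m$-dissections of $P$; these are the facets of $\Delta^m(A_n)$. The negative simple roots are identified with the following diagonals: for $1\le i\le \frac{n+1}{2}$, $-\alpha_{2i-1}$ is the diagonal joining vertices $(i-1)m$ and $(n+1-i)m+1$; for $1\le i\le \frac n2$, $-\alpha_{2i}$ is the diagonal joining vertices $im$ and $(n+1-i)m+1$. A dissection $D$ contains $-\alpha_i$ if the diagonal identified with $-\alpha_i$ belongs to $D$. *)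

(* Defs.v *)
From HB Require Import structures.
From mathcomp Require Import all_boot all_order all_algebra.
From mathcomp Require Import all_classical all_reals all_analysis.
Set Implicit Arguments. Unset Strict Implicit. Unset Printing Implicit Defensive.
Import Order.TTheory GRing.Theory Num.Theory.
Import numFieldNormedType.Exports.
Local Open Scope classical_set_scope.
Local Open Scope ring_scope.

(* Vectors of R^(n+1) are row vectors 'rV[R]_(n.+1); coordinate index
   k : 'I_(n.+1) stands for epsilon_(k+1). *)

Section Arrangement.
Variables (R : realType) (n m : nat).

Definition vec := 'rV[R]_(n.+1).

Definition dotv (u v : vec) : R := \sum_(k < n.+1) u 0 k * v 0 k.

Definition eroot (a b : 'I_n.+1) : vec :=
  \row_(k < n.+1) (((k == a)%:R : R) - (k == b)%:R).

Definition is_pos_root (alpha : vec) : Prop :=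
  exists a b : 'I_n.+1, (a < b)%N /\ alpha = eroot a b.

(* simple root alpha_i = eps_i - eps_(i+1), for 1 <= i <= n *)
Definition simple_root (i : nat) : vec := eroot (inord i.-1) (inord i).

Definition Vsp : set vec := [set v | \sum_(k < n.+1) v 0 k = 0].

Definition hyp (alpha : vec) (k : R) : set vec :=
  [set v | Vsp v /\ dotv v alpha = k].

Definition in_catm (alpha : vec) (k : R) : Prop :=
  is_pos_root alpha /\ exists j : nat, (j <= m)%N /\ k = j%:R.

Definition cat_complement : set vec :=
  [set v | Vsp v /\ ~ (exists alpha k, in_catm alpha k /\ dotv v alpha = k)].

Definition is_region (Rg : set vec) : Prop :=
  exists x, cat_complement x /\ Rg = connected_component cat_complement x.

Definition dominant_chamber : set vec :=
  [set v | Vsp v /\ forall alpha, is_pos_root alpha -> 0 <= dotv v alpha].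

Definition is_dominant_region (Rg : set vec) : Prop :=
  is_region Rg /\ Rg `<=` dominant_chamber.

(* H_{alpha,k} is a wall of Rg: it is a hyperplane of the arrangement and it
   supports a facet of Rg, i.e. closure Rg meets the hyperplane in a set with
   nonempty interior relative to the hyperplane (dimension n-1). *)
Definition is_wall (Rg : set vec) (alpha : vec) (k : R) : Prop :=
  in_catm alpha k /\
  exists p, hyp alpha k p /\
    exists2 e : R, 0 < e &
      forall q, hyp alpha k q -> ball p e q -> closure Rg q.

Definition separates_origin (Rg : set vec) (alpha : vec) (k : R) : Prop :=
  ((forall v, Rg v -> k < dotv v alpha) /\ dotv 0 alpha < k) \/
  ((forall v, Rg v -> dotv v alpha < k) /\ k < dotv 0 alpha).

Definition is_separating_wall (Rg : set vec) (alpha : vec) (k : R) : Prop :=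
  is_wall Rg alpha k /\ separates_origin Rg alpha k.

End Arrangement.

Section Dissections.
Variables (n m : nat).

(* number of vertices of P, labelled 0 .. N-1 counterclockwise *)
Definition nverts : nat := m * n.+1 + 2.

Definition diag := ('I_nverts * 'I_nverts)%type.

Definition is_diagonal (d : diag) : bool :=
  [&& (d.1 < d.2)%N, (d.1.+2 <= d.2)%N & ~~ ((d.1 == 0 :> nat) && (d.2 == nverts.-1 :> nat))].

(* the two sub-polygons have d.2-d.1+1 and nverts-(d.2-d.1)+1 vertices *)
Definition is_mdiag (d : diag) : bool :=
  [&& is_diagonal d,
      ((d.2 - d.1).+1 == 2 %[mod m])%N &
      ((nverts - (d.2 - d.1)).+1 == 2 %[mod m])%N].

Definition cross (d e : diag) : bool :=
  [|| [&& (d.1 < e.1)%N, (e.1 < d.2)%N & (d.2 < e.2)%N] |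
      [&& (e.1 < d.1)%N, (d.1 < e.2)%N & (e.2 < d.2)%N]].

Definition is_mdissection (D : {set diag}) : Prop :=
  [/\ forall d, d \in D -> is_mdiag d,
      #|D| = n &
      forall d e, d \in D -> e \in D -> ~~ cross d e].

Definition negsimple_diag (i : nat) : nat * nat :=
  if odd i then let j := i.+1./2 in ((j.-1) * m, (n.+1 - j) * m + 1)%N
  else let j := i./2 in (j * m, (n.+1 - j) * m + 1)%N.

Definition contains_negsimple (D : {set diag}) (i : nat) : Prop :=
  exists2 d, d \in D & (nat_of_ord d.1, nat_of_ord d.2) = negsimple_diag i.

End Dissections.

(* Main.v *)
(* Both sides are encoded by sequences c_0 <= ... <= c_n with c_b <= m b.

   A dominant region is a sign pattern of x_0 > ... > x_n; put
   c_b = #{(a, k) : a < b, 1 <= k <= m, x_a - x_b > k}.  Placing the points one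
   after the other, c_b tells where x_b falls among the already ordered numbers
   x_a - k, so c determines the region, and every c occurs.  The hyperplane
   H_{alpha_i, m} separates the region from the origin iff c_i = m i, and it is
   then automatically a wall: the points x_a with a < i may be pushed rigidly
   towards the others until x_(i-1) - x_i = m.

   For a dissection D, let an interval [l, r] of vertices grow from an edge to
   the whole polygon, one vertex at a time, on the side prescribed by the snake
   of negative simple roots, so that -alpha_i is one of the intervals met.  Let
   e_t be the number of diagonals of D (and of the outer edge 0, m(n+1)+1)
   inside the interval of length t + 1.  The vertices not hidden by a diagonal
   inside the interval form a chain; a new vertex v adds one link, and each new
   diagonal at v removes m links from the end of the chain next to v.  Hence
   m e_t <= t, the sequence e determines D, every such e occurs, and -alpha_i
   belongs to D iff e_t = n + 1 - i for t = m (n + 1 - i).  Finally c and e are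
   conjugate: e_t = #{a : c_a + t >= m (n + 1)}. *)

Require Import Defs.
From HB Require Import structures.
From mathcomp Require Import all_boot all_order all_algebra.
From mathcomp Require Import all_classical all_reals all_analysis.
From mathcomp Require Import zify ring lra.
Set Implicit Arguments. Unset Strict Implicit. Unset Printing Implicit Defensive.

(** * Noncrossing chords *)

Lemma sorted_ltn_filter_geq (u : nat) (s : seq nat) :
  sorted ltn s -> u \in s -> [seq x <- s | u <= x] = drop (index u s) s.
Proof.
elim: s => //= x s IHs sxs; rewrite inE.
have ss : sorted ltn s := path_sorted sxs.
have /allP lt_x : all (ltn x) s := order_path_min ltn_trans sxs.
case: eqVneq => [-> _|ne_ux /= us].
  rewrite leqnn; congr cons; apply/all_filterP/allP => y /lt_x.
  exact: ltnW.
have := lt_x _ us; rewrite /= ltnNge => /negPf ->.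
by rewrite /= ?(negPf ne_ux) ?[x == u]eq_sym ?(negPf ne_ux) /=; exact: IHs.
Qed.

(** An up-closed set of numbers below [N] is a final segment, so its size alone decides which
    numbers it contains. Conjugation of sequences rests on this in both directions. *)
Lemma upper_count (P : pred nat) (N a : nat) :
  (forall i j, i <= j -> j < N -> P i -> P j) -> a < N ->
  (N - a <= count P (iota 0 N)) = P a.
Proof.
move=> upP ltaN; have -> : iota 0 N = iota 0 a ++ iota a (N - a).
  by rewrite -{2}(add0n a) -iotaD subnKC // ltnW.
rewrite count_cat; have [Pa|nPa] := boolP (P a).
  suff -> : count P (iota a (N - a)) = N - a by rewrite leq_addl.
  rewrite -[RHS](size_iota a); apply/eqP; rewrite -all_count; apply/allP => j.
  by rewrite mem_iota => /andP[laj ltj]; apply: (upP a) => //; lia.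
have -> : count P (iota 0 a) = 0.
  apply/eqP; rewrite -leqn0 leqNgt -has_count; apply/hasPn => j.
  rewrite mem_iota => /andP[_ ltja]; apply: contra nPa; apply: upP => //; lia.
have -> : N - a = (N - a.+1).+1 by lia.
rewrite /= (negPf nPa); apply/negbTE; rewrite -ltnNge ltnS.
by rewrite -{2}(size_iota a.+1 (N - a.+1)) !add0n count_size.
Qed.

Section Chords.
Variable m : nat.
Implicit Types (G : seq (nat * nat)) (d : nat * nat).

Definition noncrossing G :=
  {in G &, forall d e, ~~ [&& d.1 < e.1, e.1 < d.2 & d.2 < e.2]}.

(** The congruence says that the polygon on the vertices from [d.1] to [d.2] has a number of
    vertices congruent to 2 modulo [m]. *)
Definition mchord d := (d.1.+1 < d.2) && (d.2 == d.1.+1 %[mod m]).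

Definition good G := [/\ uniq G, {in G, forall d, mchord d} & noncrossing G].

Definition inside l r d := (l <= d.1) && (d.2 <= r).

Definition cnt G l r := count (inside l r) G.

Definition hidden G l r x := has (fun d => inside l r d && (d.1 < x < d.2)) G.

(** The path from [l] to [r] that remains once every chord inside the interval has cut off the
    vertices below it. *)
Definition visible G l r := [seq x <- iota l (r.+1 - l) | ~~ hidden G l r x].

Lemma mem_visible G l r x :
  (x \in visible G l r) = [&& l <= x, x <= r & ~~ hidden G l r x].
Proof.
rewrite mem_filter mem_iota andbC -andbA; case: (leqP l x) => //= le_lx.
by congr (_ && _); lia.
Qed.

Lemma visible_sorted G l r : sorted ltn (visible G l r).
Proof. exact: sorted_filter ltn_trans _ _ (iota_ltn_sorted _ _). Qed.

Lemma visible_uniq G l r : uniq (visible G l r).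
Proof. exact: filter_uniq (iota_uniq _ _). Qed.

Lemma visible_left G l r : l <= r -> l \in visible G l r.
Proof.
move=> lr; rewrite mem_visible leqnn lr /=; apply/hasPn => d _.
by rewrite /inside; lia.
Qed.

Lemma visible_right G l r : l <= r -> r \in visible G l r.
Proof.
move=> lr; rewrite mem_visible leqnn lr /=; apply/hasPn => d _.
by rewrite /inside; lia.
Qed.

(** Such a chord starts to the left of [l], so any chord inside the interval hiding [d.2] would
    cross it. *)
Lemma visible_end G l r d : good G -> d \in G -> ~~ inside l r d ->
  l <= d.2 <= r -> d.2 \in visible G l r.
Proof.
move=> [_ _ ncG] dG nin /andP[ld dr]; rewrite mem_visible ld dr /=.
apply/hasPn => e eG; have := ncG d e dG eG; move: nin; rewrite /inside.
lia.
Qed.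

Lemma eq_visible G1 G2 l r :
  (forall d, inside l r d -> (d \in G1) = (d \in G2)) ->
  visible G1 l r = visible G2 l r.
Proof.
move=> eqG; apply: eq_filter => x; congr negb.
apply/hasP/hasP => -[d dG /andP[din dx]]; exists d; rewrite ?din ?dx //.
  by rewrite -eqG.
by rewrite eqG.
Qed.

Definition fan G l r := [seq d <- G | (d.1 == l) && (d.2 <= r)].

Lemma mem_fan G l r d :
  (d \in fan G l r) = [&& d.1 == l, d.2 <= r & d \in G].
Proof. by rewrite mem_filter andbA. Qed.

(** The farthest neighbour of [l] in the interval. The default [l.+1] is the neighbour along the
    polygon when no chord of the interval starts at [l]. *)
Definition apex G l r := foldr (fun d => maxn d.2) l.+1 (fan G l r).

Lemma fan_leq_apex G l r d : d \in fan G l r -> d.2 <= apex G l r.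
Proof.
rewrite /apex; elim: (fan G l r) => //= e s IHs; rewrite inE.
case/orP => [/eqP->|/IHs]; lia.
Qed.

Lemma apexP G l r :
  apex G l r = l.+1 \/ (l, apex G l r) \in fan G l r.
Proof.
have : all (fun d => d.1 == l) (fan G l r).
  by apply/allP => d; rewrite mem_fan => /and3P[].
rewrite /apex; elim: (fan G l r) => [|[a b] s IHs] /=; first by left.
case/andP => /eqP-> /IHs; set w := foldr _ _ _ => IH.
case: (leqP b w) => [bw|wb].
  by case: IH => [->|ws]; [left|right; rewrite inE ws orbT].
by right; rewrite inE eqxx.
Qed.

Lemma cnt_left G l r : cnt G l r = cnt G l.+1 r + size (fan G l r).
Proof.
rewrite /cnt /fan size_filter; elim: G => //= d s ->.
by rewrite /inside; lia.
Qed.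

Section LeftExtension.
Variables (G : seq (nat * nat)) (l r : nat).
Hypotheses (gG : good G) (ltlr : l < r).
Let w := visible G l.+1 r.
Let u := apex G l r.

Lemma fan_visible d : d \in fan G l r -> d.2 \in w.
Proof.
rewrite mem_fan => /and3P[/eqP dl dr dG]; apply: visible_end => //.
  by rewrite /inside dl; lia.
by case: gG => _ /(_ _ dG)/andP[]; rewrite dl; lia.
Qed.

Lemma apex_visible : u \in w.
Proof.
rewrite /u; case: (apexP G l r) => [->|]; first exact: visible_left.
exact: fan_visible.
Qed.

(** The chords starting at [l] hide exactly what lies strictly between [l] and the apex, so the new
    path jumps from [l] to the apex. *)
Lemma visible_left_step : visible G l r = l :: drop (index u w) w.
Proof.
rewrite -sorted_ltn_filter_geq ?visible_sorted ?apex_visible //.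
rewrite /w /visible subSS (_ : r.+1 - l = (r - l).+1) /=; last by lia.
have -> : hidden G l r l = false by apply/hasPn => d _; rewrite /inside; lia.
rewrite -filter_predI /=; congr cons; apply: eq_in_filter => x.
rewrite mem_iota => xr /=; rewrite -[RHS]negbK; congr negb.
rewrite negb_and negbK -ltnNge.
apply/hasP/orP => [[d dG /andP[/andP[ld dr] /andP[dx xd]]]|].
  case: (ltnP l d.1) => [ltld|ledl].
    by right; apply/hasP; exists d => //; rewrite /inside ltld dr dx.
  left; apply: (leq_trans xd); apply: fan_leq_apex; rewrite mem_fan dG dr.
  by rewrite /= andbT eqn_leq ledl ld.
case=> [ltxu|/hasP[d dG /andP[/andP[ld dr] dx]]]; last first.
  by exists d => //; rewrite /inside dr dx (ltnW ld).
have [ul|] := apexP G l r; first by move: ltxu xr; rewrite /u ul; lia.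
rewrite -/u mem_fan => /and3P[_ ur uG]; exists (l, u) => //=.
by rewrite /inside leqnn ur ltxu /=; lia.
Qed.

Lemma size_visible_left :
  size (visible G l r) + index u w = (size w).+1.
Proof.
rewrite visible_left_step /= size_drop.
have : index u w < size w by rewrite index_mem apex_visible.
lia.
Qed.

End LeftExtension.

Lemma index_visible_left G l r : l <= r -> index l (visible G l r) = 0.
Proof.
move=> lr; have := visible_left G lr.
rewrite /visible (_ : r.+1 - l = (r - l).+1) /=; last by lia.
by case: ifP => /= [_|_]; rewrite ?eqxx // mem_filter mem_iota ltnn andbF.
Qed.

(** Each link of the visible path is an edge or a chord, and both advance by 1 modulo [m]. In the
    induction the initial part skipped by the jump to the apex has length divisible by [m], because
    the apex is congruent to [l.+1]. *)
Lemma visible_mod G l r x : good G -> l <= r -> x \in visible G l r ->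
  x = l + index x (visible G l r) %[mod m].
Proof.
move=> gG; move Dk: (r - l) => k; elim: k l Dk x => [|k IHk] l Dk x lr.
  rewrite mem_visible => /and3P[lx xr _]; have -> : x = l by lia.
  suff -> : index l (visible G l r) = 0 by rewrite addn0.
  rewrite /visible (_ : r.+1 - l = 1) /=; last by lia.
  by case: ifP => //=; rewrite eqxx.
have ltlr : l < r by lia.
have Dk' : r - l.+1 = k by lia.
rewrite (visible_left_step gG ltlr); set w := visible G l.+1 r; set u := apex G l r.
rewrite inE; case: eqVneq => [-> _|nxl /= xw]; first by rewrite /= eqxx addn0.
have uw : u \in w by exact: apex_visible.
have idu : index u w = 0 %[mod m].
  have [ul|] := apexP G l r.
    by rewrite /u ul /w index_visible_left.
  rewrite -/u mem_fan => /and3P[_ ur uG].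
  have [_ /(_ _ uG)/andP[_ /eqP /= eu] _] := gG.
  have := IHk _ Dk' _ ltlr uw; rewrite -/w eu -{1}[l.+1]addn0 => /eqP.
  by rewrite eqn_modDl => /eqP.
have xw' : x \in w by apply: mem_drop xw.
have := IHk _ Dk' _ ltlr xw'; rewrite -/w => ->.
have w_uniq : uniq w by exact: visible_uniq.
have -> : index x w = index u w + index x (drop (index u w) w).
  rewrite -{1}(cat_take_drop (index u w) w) index_cat.
  have : uniq (take (index u w) w ++ drop (index u w) w) by rewrite cat_take_drop.
  rewrite cat_uniq => /and3P[_ /hasPn/(_ x xw)/= /negPf -> _].
  by rewrite size_takel // ltnW // index_mem.
rewrite /= eq_sym (negPf nxl) addSnnS -addnS addnCA.
by rewrite -modnDml idu modnDml add0n.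
Qed.

(** * Reflection of the polygon *)

Definition bounded N G := {in G, forall d, d.2 <= N}.

(** The ends are exchanged so that the reflected pair is again increasing. Reflection turns
    statements on the left end of an interval into statements on its right end. *)
Definition flip N d := (N - d.2, N - d.1).

Definition mirror N G := map (flip N) G.

Lemma chord_lt G d : good G -> d \in G -> d.1.+1 < d.2.
Proof. by case=> _ + _ dG => /(_ d dG)/andP[]. Qed.

Lemma flipK N G : good G -> bounded N G -> {in G, cancel (flip N) (flip N)}.
Proof.
move=> gG bG d dG; have := bG d dG; have := chord_lt gG dG.
by case: d {dG} => a b /= ab bN; rewrite /flip /=; congr pair; lia.
Qed.

Lemma mem_mirror N G d : good G -> bounded N G -> d.1 < d.2 -> d.2 <= N ->
  (d \in mirror N G) = (flip N d \in G).
Proof.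
move=> gG bG d12 dN; have fd : flip N (flip N d) = d.
  by case: d d12 dN => a b /= ab bN; rewrite /flip /=; congr pair; lia.
apply/mapP/idP => [[e eG ->]|fG]; first by rewrite (flipK gG bG).
by exists (flip N d).
Qed.

Lemma good_mirror N G : good G -> bounded N G -> good (mirror N G).
Proof.
move=> gG bG; have [uG mG ncG] := gG; split.
- by rewrite map_inj_in_uniq // => d e dG eG; exact: (can_in_inj (flipK gG bG)).
- move=> _ /mapP[d dG ->]; have := bG d dG; have /andP[d12 /eqP dm] := mG d dG.
  case: d {dG} d12 dm => a b /= ab dm bN; apply/andP; split => /=.
    by clear dm; lia.
  rewrite -(eqn_modDl b.-1).
  have [-> ->] : b.-1 + (N - a) = N - a.+1 + b /\
                 b.-1 + (N - b).+1 = N - a.+1 + a.+1 by clear dm; lia.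
  by rewrite eqn_modDl dm.
move=> _ _ /mapP[d dG ->] /mapP[e eG ->] /=.
have := bG d dG; have := bG e eG; have := chord_lt gG dG; have := chord_lt gG eG.
have := ncG e d eG dG; lia.
Qed.

Lemma inside_flip N l r d : l <= N -> r <= N -> d.1 <= N -> d.2 <= N ->
  inside l r (flip N d) = inside (N - r) (N - l) d.
Proof. by rewrite /inside /=; lia. Qed.

Lemma cnt_mirror N G l r : good G -> bounded N G -> l <= N -> r <= N ->
  cnt (mirror N G) l r = cnt G (N - r) (N - l).
Proof.
move=> gG bG lN rN; rewrite /cnt count_map; apply: eq_in_count => d dG /=.
have := bG d dG; have := chord_lt gG dG => d12 d2N.
by rewrite inside_flip //; lia.
Qed.

Lemma size_visible_mirror N G l r : good G -> bounded N G -> l <= N -> r <= N ->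
  size (visible (mirror N G) l r) = size (visible G (N - r) (N - l)).
Proof.
move=> gG bG lN rN; rewrite -(size_map (subn N)); apply: perm_size.
apply: uniq_perm; [|exact: visible_uniq|move=> x].
  rewrite map_inj_in_uniq ?visible_uniq // => x y.
  by rewrite !mem_visible; lia.
have hid y : y <= N -> hidden (mirror N G) l r y = hidden G (N - r) (N - l) (N - y).
  move=> yN; rewrite /hidden has_map; apply: eq_in_has => d dG /=.
  have := bG d dG; have := chord_lt gG dG; rewrite /inside /=; lia.
apply/mapP/idP => [[y]|]; rewrite mem_visible => /and3P[lx xr hx].
  by move=> ->; rewrite mem_visible -hid ?hx; lia.
exists (N - x); last by lia.
rewrite mem_visible hid ?subKn ?hx //; lia.
Qed.

Lemma cnt_single G l : good G -> cnt G l l = 0.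
Proof.
move=> gG; apply/eqP; rewrite -leqn0 leqNgt -has_count; apply/hasPn => d dG.
by have := chord_lt gG dG; rewrite /inside; lia.
Qed.

Lemma size_visible_single G l : size (visible G l l) = 1.
Proof.
have := visible_left G (leqnn l); rewrite /visible subSnn /=.
by case: ifP.
Qed.

Lemma size_visible_ge2 G l r : l < r -> 1 < size (visible G l r).
Proof.
move=> lr; have s : {subset [:: l; r] <= visible G l r}.
  move=> x; rewrite !inE => /orP[]/eqP->; last by rewrite visible_right // ltnW.
  by rewrite visible_left // ltnW.
by apply: (uniq_leq_size _ s); rewrite /= inE andbT; lia.
Qed.

Hypothesis m_gt0 : 0 < m.

(** * The weight of an interval and the chords at a new vertex *)

Section LeftCount.
Variables (G : seq (nat * nat)) (l r : nat).
Hypotheses (gG : good G) (ltlr : l < r).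
Let w := visible G l.+1 r.
Let u := apex G l r.
Let ranks := [seq index d.2 w %/ m | d <- fan G l r].

Lemma fan_index d : d \in fan G l r ->
  0 < index d.2 w /\ m %| index d.2 w.
Proof.
move=> df; have dw := fan_visible gG ltlr df.
move: df; rewrite mem_fan => /and3P[/eqP dl dr dG].
have [_ /(_ _ dG)/andP[]] := gG; rewrite dl => ltd /eqP ed _.
split.
  rewrite lt0n; apply/eqP => id0; have := nth_index 0 dw; rewrite id0.
  move: (visible_left G ltlr) (visible_sorted G l.+1 r); rewrite -/w.
  case: (w) => //= x s; rewrite inE => /orP[/eqP<- _|ls]; first by lia.
  move/(order_path_min ltn_trans)/allP/(_ _ ls) => /=; lia.
have := visible_mod gG ltlr dw; rewrite -/w ed -{1}[l.+1]addn0 => /eqP.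
by rewrite eqn_modDl eq_sym mod0n.
Qed.

Lemma ranks_uniq : uniq ranks.
Proof.
rewrite map_inj_in_uniq; last first.
  move=> d e df ef; have [_ dd] := fan_index df; have [_ de] := fan_index ef.
  move/eqP; rewrite -(eqn_pmul2r m_gt0) !divnK // => /eqP.
  have dw := fan_visible gG ltlr df; have ew := fan_visible gG ltlr ef.
  move/(congr1 (nth 0 w)); rewrite !nth_index //.
  move: df ef; rewrite !mem_fan => /and3P[/eqP d1 _ _] /and3P[/eqP e1 _ _] de2.
  by rewrite [d]surjective_pairing [e]surjective_pairing d1 e1 de2.
by apply: filter_uniq; case: gG.
Qed.

Lemma ranks_sub : {subset ranks <= iota 1 (index u w %/ m)}.
Proof.
move=> k /mapP[d df ->]; have [d0 dd] := fan_index df.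
rewrite mem_iota divn_gt0 // dvdn_leq //= add1n ltnS leq_div2r //.
rewrite leqNgt; apply/negP => ltu.
have := sorted_ltn_nth ltn_trans 0 (visible_sorted G l.+1 r).
move=> /(_ (index u w) (index d.2 w)); rewrite !inE !index_mem.
rewrite apex_visible // (fan_visible gG ltlr df) ltu => /(_ isT isT isT).
rewrite !nth_index ?apex_visible ?(fan_visible gG ltlr df) //.
by rewrite ltnNge fan_leq_apex.
Qed.

(* Consecutive visible vertices differ by 1 modulo [m], so the far ends of the
   chords at [l] have ranks divisible by [m] in the chain [w]. *)
Lemma size_fan_leq : m * size (fan G l r) <= index u w.
Proof.
have := uniq_leq_size ranks_uniq ranks_sub; rewrite size_map size_iota => le_fan.
by rewrite (leq_trans (leq_mul (leqnn m) le_fan)) // mulnC leq_divM.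
Qed.

(** Equality case of the preceding bound: the ranks divided by [m] must then exhaust an initial
    segment of the positive integers, so the chords at [l] go to the visible vertices of rank [m],
    [2m], and so on. The fan is thus determined by its size. *)
Lemma fan_mem j : index u w = m * size (fan G l r) ->
  ((l, j) \in G) && (j <= r) =
  [&& j \in w, 0 < index j w, m %| index j w & index j w <= m * size (fan G l r)].
Proof.
move=> eu; have sK : size ranks = size (fan G l r) by rewrite size_map.
have eK : index u w %/ m = size (fan G l r) by rewrite eu mulKn.
have leK : size (iota 1 (index u w %/ m)) <= size ranks by rewrite size_iota eK sK.
have [_ KE] := uniq_min_size ranks_uniq ranks_sub leK.
apply/idP/idP => [/andP[jG jr]|/and4P[jw j0 jd jle]].
  have jf : (l, j) \in fan G l r by rewrite mem_fan eqxx jr jG.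
  have [j0 jd] := fan_index jf; rewrite (fan_visible gG ltlr jf) j0 jd /=.
  have /ranks_sub : index j w %/ m \in ranks by apply/mapP; exists (l, j).
  by rewrite mem_iota eK add1n ltnS => /andP[_]; rewrite leq_divLR // mulnC.
have : index j w %/ m \in ranks.
  rewrite KE mem_iota divn_gt0 // dvdn_leq //= eK add1n ltnS.
  by rewrite leq_divLR // mulnC.
case/mapP => d df /eqP; have [_ dd] := fan_index df.
rewrite -(eqn_pmul2r m_gt0) !divnK // => /eqP.
move/(congr1 (nth 0 w)); rewrite !nth_index ?(fan_visible gG ltlr df) // => ->.
by case: d dd df => a b _; rewrite mem_fan /= => /and3P[/eqP-> -> ->].
Qed.

(** Adding [l] gives one new visible vertex, hides [index u w] old ones and brings in the chords of
    the fan, whose contribution to the weight is at most [index u w]. *)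
Lemma weight_left :
  size (visible G l r) + m * cnt G l r <=
  (size (visible G l.+1 r) + m * cnt G l.+1 r).+1.
Proof.
have := size_visible_left gG ltlr; have := size_fan_leq.
rewrite cnt_left mulnDr /u /w; lia.
Qed.

End LeftCount.

Lemma weight_right N G l r : good G -> bounded N G -> l < r.+1 <= N ->
  size (visible G l r.+1) + m * cnt G l r.+1 <=
  (size (visible G l r) + m * cnt G l r).+1.
Proof.
move=> gG bG /andP[lr rN].
have ltN : N - r.+1 < N - l by lia.
have := weight_left (good_mirror gG bG) ltN.
rewrite !size_visible_mirror // ?cnt_mirror //; try lia.
rewrite !subKn //; try lia.
by have -> : N - (N - r.+1).+1 = r by lia.
Qed.

Lemma weight_bound G l r : good G -> l <= r ->
  size (visible G l r) + m * cnt G l r <= (r - l).+1.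
Proof.
move=> gG; move Dk: (r - l) => k; elim: k l Dk => [|k IHk] l Dk lr.
  have -> : l = r by lia.
  by rewrite cnt_single // size_visible_single muln0.
have ltlr : l < r by lia.
apply: leq_trans (weight_left gG ltlr) _; rewrite ltnS; apply: IHk; lia.
Qed.

Definition tight G l r := size (visible G l r) + m * cnt G l r = (r - l).+1.

(** The weight grows by at most 1 with each new vertex, so attaining the maximum on the whole
    polygon forces a growth of exactly 1 at every step, in whichever order the vertices are
    added. *)
Lemma tight_inside N G l r : good G -> bounded N G -> tight G 0 N ->
  l <= r <= N -> tight G l r.
Proof.
move=> gG bG tG /andP[lr rN].
have tl k r' : k <= r' -> tight G 0 r' -> tight G k r'.
  elim: k => // k IHk kr t0; have := IHk (ltnW kr) t0; rewrite /tight.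
  have := weight_left gG kr; have := weight_bound gG kr; lia.
apply: tl => //; move Dk: (N - r) => k; elim: k r rN {lr} Dk => [|k IHk] r rN Dk.
  by have -> : r = N by lia.
have : tight G 0 r.+1 by apply: IHk; lia.
rewrite /tight.
have rN' : 0 < r.+1 <= N by lia.
have := weight_right gG bG rN'; have := weight_bound gG (leq0n r); lia.
Qed.

Lemma tight_fan_size G l r : good G -> l < r -> tight G l r -> tight G l.+1 r ->
  index (apex G l r) (visible G l.+1 r) = m * size (fan G l r).
Proof.
move=> gG lr; have := size_visible_left gG lr; rewrite /tight cnt_left mulnDr.
lia.
Qed.

(** Only the chords at [l] are in question. Both sets have the same visible path over [[l.+1, r]]
    and equally many chords at [l]; by tightness these data determine the fan. *)
Lemma eq_inside_left G1 G2 l r : good G1 -> good G2 -> l < r ->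
  tight G1 l r -> tight G1 l.+1 r -> tight G2 l r -> tight G2 l.+1 r ->
  cnt G1 l r = cnt G2 l r ->
  (forall d, inside l.+1 r d -> (d \in G1) = (d \in G2)) ->
  forall d, inside l r d -> (d \in G1) = (d \in G2).
Proof.
move=> g1 g2 lr t1 t1' t2 t2' ec eG [a b] din.
have ew : visible G1 l.+1 r = visible G2 l.+1 r by exact: eq_visible.
have ef : size (fan G1 l r) = size (fan G2 l r).
  move: ec; rewrite (cnt_left G1) (cnt_left G2); move: t1' t2'.
  rewrite /tight ew => <- /eqP; rewrite eqn_add2l eqn_pmul2l // => /eqP->.
  by move=> /eqP; rewrite eqn_add2l => /eqP.
case: (ltnP l a) => la; first by apply: eG; move: din; rewrite /inside /=; lia.
have [-> br] : a = l /\ b <= r by move: din; rewrite /inside /=; lia.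
have := fan_mem g1 lr b (tight_fan_size g1 lr t1 t1').
have := fan_mem g2 lr b (tight_fan_size g2 lr t2 t2').
by rewrite br !andbT ew ef => -> ->.
Qed.

Lemma eq_inside_right N G1 G2 l r : good G1 -> good G2 ->
  bounded N G1 -> bounded N G2 -> l < r.+1 <= N ->
  tight G1 0 N -> tight G2 0 N ->
  cnt G1 l r.+1 = cnt G2 l r.+1 ->
  (forall d, inside l r d -> (d \in G1) = (d \in G2)) ->
  forall d, inside l r.+1 d -> (d \in G1) = (d \in G2).
Proof.
move=> g1 g2 b1 b2 lrN t1 t2 ec eG d din.
have tm G a b : good G -> bounded N G -> tight G 0 N -> a <= b <= N ->
    tight (mirror N G) a b.
  move=> g bG t abN; rewrite /tight size_visible_mirror ?cnt_mirror //; try lia.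
  have -> : (b - a).+1 = (N - a - (N - b)).+1 by lia.
  by apply: (tight_inside g bG t); lia.
(* Reflection is an involution on increasing pairs only; other pairs belong to neither set. *)
case d12: (d.1 < d.2); last first.
  have nG G : good G -> (d \in G) = false.
    by move=> g; apply/negP => /(chord_lt g); lia.
  by rewrite !nG.
have dN : d.2 <= N by move: din; rewrite /inside; lia.
have ed G : good G -> bounded N G -> (d \in G) = (flip N d \in mirror N G).
  move=> g bG; rewrite mem_mirror //=; try lia.
  have -> // : flip N (flip N d) = d.
  by case: (d) d12 dN => a b /= ab bN; rewrite /flip /=; congr pair; lia.
rewrite !ed //; apply: (@eq_inside_left _ _ (N - r.+1) (N - l)).
- exact: good_mirror.
- exact: good_mirror.
- by lia.
- by apply: tm => //; lia.
- by apply: tm => //; lia.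
- by apply: tm => //; lia.
- by apply: tm => //; lia.
- rewrite !cnt_mirror ?subKn //; lia.
- move=> e ein; case e12: (e.1 < e.2); last first.
    have nG G : good G -> bounded N G -> (e \in mirror N G) = false.
      by move=> g bG; apply/negP => /(chord_lt (good_mirror g bG)); lia.
    by rewrite !nG.
  have eN : e.2 <= N by move: ein; rewrite /inside; lia.
  by rewrite !mem_mirror //; apply: eG; move: ein; rewrite /inside /=; lia.
by move: din; rewrite /inside /=; lia.
Qed.

(** Under tightness the numerical condition says that only [l] and [r] are visible. The apex is then
    [r], and since [r] is not [l.+1] it comes from a chord. *)
Lemma mem_chord_tight G l r : good G -> l.+1 < r -> tight G l r ->
  ((l, r) \in G) = ((m * cnt G l r).+1 == r - l).
Proof.
move=> gG lr tG; have lr' : l < r by lia.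
have -> : ((m * cnt G l r).+1 == r - l) = (size (visible G l r) == 2).
  by move: tG; rewrite /tight; lia.
apply/idP/eqP => [lrG|].
  apply/eqP; rewrite eqn_leq size_visible_ge2 // andbT.
  have s : {subset visible G l r <= [:: l; r]}.
    move=> x; rewrite mem_visible !inE => /and3P[lx xr /hasPn/(_ _ lrG)].
    by rewrite /inside /=; lia.
  exact: (uniq_leq_size (visible_uniq G l r) s).
rewrite (visible_left_step gG lr') -sorted_ltn_filter_geq ?visible_sorted //; last first.
  exact: (apex_visible gG lr').
set s := [seq _ <- _ | _] => -[s1].
have rs : r \in s.
  rewrite mem_filter visible_right ?andbT; last by lia.
  case: (apexP G l r) => [->|]; first by lia.
  by rewrite mem_fan => /and3P[].
have us : apex G l r \in s by rewrite mem_filter leqnn (apex_visible gG lr').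
have ur : apex G l r = r.
  by move: rs us; case: (s) s1 => [|a [|]] //= _; rewrite !inE => /eqP<- /eqP.
case: (apexP G l r); first by lia.
by rewrite ur mem_fan => /and3P[].
Qed.

(** Two vertices are always visible, so the weight is at least [N.+1], which is also its upper
    bound. *)
Lemma full_tight G N : good G -> {in G, forall d, inside 0 N d} ->
  (m * size G).+1 = N -> tight G 0 N.
Proof.
move=> gG iG sG; have sc : cnt G 0 N = size G.
  by apply/eqP; rewrite -all_count; apply/allP.
have N0 : 0 < N by lia.
have := weight_bound gG (leq0n N); have := size_visible_ge2 G N0.
rewrite /tight sc; lia.
Qed.

(** * Construction of chord sets vertex by vertex *)

Lemma extend_left G l r k : good G -> l < r ->
  {in G, forall d, inside l.+1 r d} -> tight G l.+1 r ->
  m * k < size (visible G l.+1 r) ->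
  exists G', [/\ good G', {in G', forall d, inside l r d},
    forall a b, l < a -> cnt G' a b = cnt G a b,
    cnt G' l r = cnt G l.+1 r + k & tight G' l r].
Proof.
move=> gG lr iG tG ltk; set w := visible G l.+1 r in ltk *.
(* The new vertex is joined to the visible vertices of rank [m], [2m], ..., [k * m]: visibility
   prevents crossings, and the ranks give the right congruence. *)
pose F := [seq (l, nth 0 w (m * j)) | j <- iota 1 k].
have Fw d : d \in F -> [/\ d.1 = l, d.2 \in w, 0 < index d.2 w,
    index d.2 w <= m * k & m %| index d.2 w].
  case/mapP => j; rewrite mem_iota => /andP[j0 jk] ->.
  have jw : m * j < size w by apply: leq_ltn_trans ltk; rewrite leq_pmul2l //; lia.
  split=> //=; rewrite ?mem_nth // index_uniq ?visible_uniq //.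
  - by rewrite muln_gt0 m_gt0 j0.
  - by rewrite leq_pmul2l //; lia.
  - exact: dvdn_mulr.
have uG' : uniq (F ++ G).
  have [uG _ _] := gG; rewrite cat_uniq uG andbT; apply/andP; split.
    rewrite map_inj_in_uniq ?iota_uniq // => i j.
    rewrite !mem_iota => ik jk [] /eqP.
    rewrite nth_uniq ?visible_uniq // ?eqn_pmul2l //; first by move/eqP.
      by apply: leq_ltn_trans ltk; rewrite leq_pmul2l //; lia.
    by apply: leq_ltn_trans ltk; rewrite leq_pmul2l //; lia.
  apply/hasPn => d dG; apply/negP => /Fw[dl _ _ _ _].
  by have := iG d dG; rewrite /inside dl; lia.
have gG' : good (F ++ G).
  have [_ mG ncG] := gG; split=> // [d|d e].
    rewrite mem_cat => /orP[dF|]; last exact: mG.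
    have [d1 d2 i0 _ im] := Fw d dF; apply/andP; split.
      have : d.2 != l.+1.
        by apply/eqP => dl; move: i0; rewrite dl /w index_visible_left.
      by move: d2; rewrite mem_visible d1 => /and3P[ld _ _] ne; rewrite ltn_neqAle eq_sym ne.
    rewrite d1 (visible_mod gG lr d2) -/w -[l.+1 in X in _ == X]addn0.
    by rewrite eqn_modDl mod0n.
  have nFG x y : x \in F -> y \in G -> ~~ [&& x.1 < y.1, y.1 < x.2 & x.2 < y.2].
    move=> xF yG; have [_ x2 _ _ _] := Fw x xF.
    have := iG y yG; move: x2; rewrite mem_visible => /and3P[_ _ /hasPn/(_ y yG)].
    by move=> + yi; rewrite yi /=; lia.
  rewrite !mem_cat => /orP[dF|dG] /orP[eF|eG].
  - by have [-> _ _ _ _] := Fw d dF; have [-> _ _ _ _] := Fw e eF; rewrite ltnn.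
  - exact: nFG.
  - have [-> _ _ _ _] := Fw e eF; have /andP[ld _] := iG d dG.
    by rewrite (ltnNge d.1) (ltnW ld).
  - exact: ncG.
have cF a b : l < a -> cnt (F ++ G) a b = cnt G a b.
  move=> la; rewrite /cnt count_cat -[RHS]add0n; congr (_ + _).
  apply/eqP; rewrite -leqn0 leqNgt -has_count; apply/hasPn => d /Fw[d1 _ _ _ _].
  by rewrite /inside d1; lia.
have sfan : size (fan (F ++ G) l r) = k.
  rewrite /fan filter_cat size_cat -[RHS]addn0; congr (_ + _).
    rewrite size_filter -[RHS](size_iota 1) -(size_map (fun j => (l, nth 0 w (m * j)))).
    apply/eqP; rewrite -all_count; apply/allP => d /Fw[-> d2 _ _ _].
    by rewrite eqxx /=; move: d2; rewrite mem_visible => /and3P[].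
  rewrite size_filter; apply/eqP; rewrite -leqn0 leqNgt -has_count.
  by apply/hasPn => d /iG/andP[ld _] /=; rewrite (gtn_eqF ld).
have ew : visible (F ++ G) l.+1 r = w.
  apply: eq_visible => d; rewrite mem_cat /inside => di.
  case dF: (d \in F) => //=; have [d1 _ _ _ _] := Fw d dF.
  by rewrite d1 ltnn in di.
exists (F ++ G); split=> //.
- move=> d; rewrite mem_cat => /orP[/Fw[d1 d2 _ _ _]|/iG]; rewrite /inside ?d1 ?leqnn.
    by move: d2; rewrite mem_visible => /and3P[].
  by lia.
- by rewrite cnt_left cF // sfan.
have := size_visible_left gG' lr; have := size_fan_leq gG' lr.
rewrite /tight cnt_left cF // sfan ew mulnDr.
(* The farthest new chord ends at rank at most [m * k]; with the opposite bound from [size_fan_leq]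
   this gives equality, hence tightness. *)
have : index (apex (F ++ G) l r) w <= m * k.
  case: (apexP (F ++ G) l r) => [->|]; first by rewrite index_visible_left.
  rewrite mem_fan mem_cat => /and3P[_ _ /orP[/Fw[]//|/iG]].
  by rewrite /inside ltnn.
by move: tG; rewrite /tight -/w; lia.
Qed.

Lemma extend_right N G l r k : good G -> l < r.+1 <= N ->
  {in G, forall d, inside l r d} -> tight G l r ->
  m * k < size (visible G l r) ->
  exists G', [/\ good G', {in G', forall d, inside l r.+1 d},
    forall a b, a <= N -> b <= r -> cnt G' a b = cnt G a b,
    cnt G' l r.+1 = cnt G l r + k & tight G' l r.+1].
Proof.
move=> gG /andP[lr rN] iG tG ltk.
have bG : bounded N G by move=> d /iG; rewrite /inside; lia.
have e1 : (N - r.+1).+1 = N - r by lia.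
have [||||G' [gG' iG' cG' kG' tG']] := @extend_left (mirror N G) (N - r.+1) (N - l) k (good_mirror gG bG).
- by lia.
- move=> _ /mapP[d dG ->]; have := iG d dG; have := bG d dG.
  by have := chord_lt gG dG; rewrite /inside /=; lia.
- rewrite /tight e1 (size_visible_mirror gG bG) ?(cnt_mirror gG bG) ?subKn //; try lia.
  by move: tG; rewrite /tight => ->; lia.
- rewrite e1 (size_visible_mirror gG bG) ?subKn //; lia.
have bG' : bounded N G' by move=> d /iG'; rewrite /inside; lia.
exists (mirror N G'); split; first exact: good_mirror.
- move=> _ /mapP[d dG ->]; have := iG' d dG; have := bG' d dG.
  by have := chord_lt gG' dG; rewrite /inside /=; lia.
- move=> a b aN br; rewrite (cnt_mirror gG' bG') //; last by lia.
  rewrite cG'; last by lia.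
  by rewrite (cnt_mirror gG bG) ?subKn //; lia.
- rewrite (cnt_mirror gG' bG') //; last by lia.
  by rewrite kG' e1 (cnt_mirror gG bG) ?subKn //; lia.
rewrite /tight (size_visible_mirror gG' bG') ?(cnt_mirror gG' bG') //; try lia.
by move: tG'; rewrite /tight => ->; lia.
Qed.

(** * Chord sets along a growing sequence of intervals *)

Section Schedule.
Variables (N : nat) (lo : nat -> nat).

(** The interval at time [t] is [[lo t, lo t + t.+1]]: it starts as an edge and gains one vertex at
    each step, on the right if [lo] is constant and on the left if [lo] drops by 1. *)
Definition schedule T :=
  (forall t, t < T -> lo t = lo t.+1 \/ lo t = (lo t.+1).+1) /\
  (forall t, t <= T -> lo t + t.+1 <= N).

Lemma scheduleW T : schedule T.+1 -> schedule T.
Proof. by case=> s1 s2; split=> t tT; [apply: s1|apply: s2]; lia. Qed.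

Lemma schedule_mono T t : schedule T -> t <= T ->
  lo T <= lo t /\ lo t + t <= lo T + T.
Proof.
elim: T => [|T IHT] sT tT; first by have -> : t = 0 by lia.
have [s1 _] := sT; case: (ltnP t T.+1) => tT'; last by have -> : t = T.+1 by lia.
by have := IHT (scheduleW sT) tT'; have := s1 T (ltnSn T); lia.
Qed.

(** The increments of the counts give the number of chords at each new vertex, and by tightness this
    number determines those chords. An initial edge contains no chord. *)
Lemma chords_unique G1 G2 T : schedule T -> good G1 -> good G2 ->
  bounded N G1 -> bounded N G2 -> tight G1 0 N -> tight G2 0 N ->
  (forall t, t <= T -> cnt G1 (lo t) (lo t + t.+1) = cnt G2 (lo t) (lo t + t.+1)) ->
  forall d, inside (lo T) (lo T + T.+1) d -> (d \in G1) = (d \in G2).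
Proof.
move=> sT g1 g2 b1 b2 t1 t2; elim: T sT => [|T IHT] sT ec.
  move=> d; rewrite /inside => di; have nG G : good G -> (d \in G) = false.
    by move=> g; apply/negP => /(chord_lt g); lia.
  by rewrite !nG.
have {}IHT := IHT (scheduleW sT) (fun t tT => ec t (leqW tT)).
have ecT := ec _ (leqnn T.+1).
have [s1 s2] := sT; have := s2 _ (leqnn T.+1) => leN.
case: (s1 T (ltnSn T)) => eT; rewrite eT in IHT.
  rewrite addnS in ecT *; apply: (eq_inside_right g1 g2 b1 b2) => //.
  by lia.
apply: (eq_inside_left g1 g2) => //; first by lia.
- by apply: (tight_inside g1 b1 t1); lia.
- by apply: (tight_inside g1 b1 t1); lia.
- by apply: (tight_inside g2 b2 t2); lia.
- by apply: (tight_inside g2 b2 t2); lia.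
by rewrite addnS -addSn.
Qed.

Lemma chords_exist T (e : nat -> nat) : schedule T ->
  e 0 = 0 -> (forall t, t < T -> e t <= e t.+1) ->
  (forall t, t <= T -> m * e t <= t) ->
  exists G, [/\ good G, {in G, forall d, inside (lo T) (lo T + T.+1) d},
    forall t, t <= T -> cnt G (lo t) (lo t + t.+1) = e t &
    tight G (lo T) (lo T + T.+1)].
Proof.
move=> + e0; elim: T => [|T IHT] sT eS eB.
  exists [::]; split=> //.
    by move=> t; rewrite leqn0 => /eqP->; rewrite e0.
  have ->: lo 0 + 1 = (lo 0).+1 by lia.
  rewrite /tight subSnn muln0 addn0; apply/eqP; rewrite eqn_leq size_visible_ge2 //.
  by rewrite size_filter (leq_trans (count_size _ _)) // size_iota; lia.
have [||G [gG iG cG tG]] := IHT (scheduleW sT).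
- by move=> t tT; apply: eS; lia.
- by move=> t tT; apply: eB; lia.
have [s1 s2] := sT; have leN := s2 _ (leqnn T.+1).
have cT := cG T (leqnn T).
(* Tightness leaves [T + 2 - m * e T] visible vertices, and [m * e T.+1 <= T.+1] says that the
   required new chords fit among them. *)
have ltk : m * (e T.+1 - e T) < size (visible G (lo T) (lo T + T.+1)).
  have := eB _ (leqnSn T); have := eB _ (leqnn T.+1).
  by move: tG; rewrite /tight cT mulnBr; lia.
have le_e := eS T (ltnSn T).
have mono t : t <= T -> lo T <= lo t /\ lo t + t <= lo T + T.
  exact: (schedule_mono (scheduleW sT)).
case: (s1 T (ltnSn T)) => eT.
  have ltN : lo T < (lo T + T.+1).+1 <= N by lia.
  have [G' [gG' iG' cG' kG' tG']] := extend_right gG ltN iG tG ltk.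
  exists G'; rewrite -eT addnS; split=> // t; rewrite leq_eqVlt => /orP[/eqP->|].
    by rewrite -eT addnS kG' cT; lia.
  by rewrite ltnS => tT; have := mono t tT => -[mo1 mo2]; rewrite cG' ?cG //; lia.
have er : lo T + T.+1 = lo T.+1 + T.+2 by lia.
rewrite er in iG tG ltk cT; rewrite eT in iG tG ltk cT.
have ltr : lo T.+1 < lo T.+1 + T.+2 by lia.
have [G' [gG' iG' cG' kG' tG']] := extend_left gG ltr iG tG ltk.
exists G'; split=> // t; rewrite leq_eqVlt => /orP[/eqP->|].
  by rewrite kG' cT; lia.
by rewrite ltnS => tT; have := mono t tT => -[mo1 mo2]; rewrite cG' ?cG //; lia.
Qed.

End Schedule.
End Chords.

(** * Conjugation of lattice paths *)

Section Conjugate.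
Variables (m n : nat).
Let M := m * n.+1.

Definition conjugate (c : nat -> nat) t := count (fun a => M <= c a + t) (iota 0 n.+1).

(** Lattice paths on one side of a line of slope [m]. The definition [coballot] below describes the
    same paths read along the other axis, starting from the far end. *)
Definition ballot (c : nat -> nat) :=
  (forall a b, a <= b -> b <= n -> c a <= c b) /\ (forall a, a <= n -> c a <= m * a).

Definition coballot (e : nat -> nat) :=
  [/\ e 0 = 0, forall t, t < M -> e t <= e t.+1,
      forall t, t <= M -> m * e t <= t & e M = n.+1].

Hypothesis m_gt0 : 0 < m.

(** Since [c] is monotone, the indices counted by [conjugate c t] form a final segment of
    [0, ..., n]. *)
Lemma conjugate_lt c a t : ballot c -> a <= n -> (n - a < conjugate c t) = (M <= c a + t).
Proof.
move=> [cS _] an; rewrite -(@upper_count (fun a => M <= c a + t) n.+1 a) //.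
  by rewrite subSn.
by move=> i j ij jn; have := cS i j ij jn; lia.
Qed.

Lemma conjugate_leq c t : conjugate c t <= n.+1.
Proof. by rewrite (leq_trans (count_size _ _)) // size_iota. Qed.

(** If the count is [k.+1], the index [n - k] is counted, so [M <= m * (n - k) + t], which is
    [m * k.+1 <= t]. *)
Lemma conjugate_coballot c : ballot c -> coballot (conjugate c).
Proof.
move=> bc; have [_ cB] := bc.
have B t : t <= M -> m * conjugate c t <= t.
  move=> tM; have := conjugate_leq c t; case E: (conjugate c t) => [|k]; first by rewrite muln0.
  move=> kn; have an : n - k <= n by lia.
  have := conjugate_lt t bc an; rewrite E; have := cB _ an.
  rewrite (_ : n - (n - k) = k) ?ltnSn; last by lia.
  rewrite /M -[n.+1](@subnK k.+1) // subSS mulnDr.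
  by move=> le1 /esym; lia.
split=> //; first by have := B 0 isT; rewrite leqn0 muln_eq0 => /orP[|]/eqP; lia.
  by move=> t _; apply: sub_count => a /=; lia.
rewrite -[RHS](size_iota 0); apply/eqP; rewrite -all_count.
by apply/allP => a _; lia.
Qed.

(** The least [t] for which [a] is counted is [M - c a], so it suffices to compare the counts at
    [M - c1 a] and [M - c2 a]. *)
Lemma conjugate_inj c1 c2 a : ballot c1 -> ballot c2 ->
  (forall t, t <= M -> conjugate c1 t = conjugate c2 t) -> a <= n -> c1 a = c2 a.
Proof.
move=> b1 b2 ec an; have leM c : ballot c -> c a <= M.
  by case=> _ /(_ a an) cM; apply: (leq_trans cM); rewrite leq_pmul2l //; lia.
have eM t : t <= M -> (M <= c1 a + t) = (M <= c2 a + t).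
  by move=> tM; rewrite -!conjugate_lt // ec.
have l1 := leM _ b1; have l2 := leM _ b2.
by have := eM _ (leq_subr (c1 a) M); have := eM _ (leq_subr (c2 a) M); lia.
Qed.

Lemma conjugate_surj e : coballot e ->
  exists2 c, ballot c & forall t, t <= M -> conjugate c t = e t.
Proof.
move=> [e0 eS eB eM].
have eMono s t : s <= t -> t <= M -> e s <= e t.
  elim: t => [|t IHt] st tM; first by have -> : s = 0 by lia.
  case: (ltnP s t.+1) => s't; last by have -> : s = t.+1 by lia.
  by have := IHt s't (ltnW tM); have := eS t tM; lia.
(* The transposed count; [cE] states that it satisfies the relation of [conjugate_lt], up to the
   last time [M] included. *)
pose c a := count (fun t => n - a < e t) (iota 0 M).
have cE a t : t <= M -> a <= n -> (M <= c a + t) = (n - a < e t).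
  move=> tM an; case: (ltnP t M) => [ltM|leM].
    rewrite -(@upper_count (fun t => n - a < e t) M t) //; first by rewrite /c; lia.
    by move=> i j ij jM; have := eMono i j ij (ltnW jM); lia.
  by have -> : t = M by [lia]; rewrite eM; lia.
exists c; first split.
- by move=> a b ab bn; apply: sub_count => t /=; lia.
- move=> a an; have aM : m * a <= M by rewrite leq_pmul2l //; lia.
  case: (leqP (c a) (m * a)) => // lt.
  have ca : c a <= M by rewrite (leq_trans (count_size _ _)) // size_iota.
  have lt' : M - c a < m * (n.+1 - a) by rewrite mulnBr -/M; lia.
  have := cE a _ (leq_subr (c a) M) an.
  rewrite (_ : M <= c a + (M - c a)); last by lia.
  move/esym => ne; have := eB _ (leq_subr (c a) M).
  have : m * (n.+1 - a) <= m * e (M - c a) by rewrite leq_pmul2l //; lia.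
  lia.
move=> t tM; have etn : e t <= n.+1 by rewrite -eM eMono.
have -> : conjugate c t = count (fun a => n - a < e t) (iota 0 n.+1).
  by apply: eq_in_count => a; rewrite mem_iota => an; rewrite cE //; lia.
have -> : iota 0 n.+1 = iota 0 (n.+1 - e t) ++ iota (n.+1 - e t) (e t).
  by rewrite -{2}(add0n (n.+1 - e t)) -iotaD subnK.
rewrite count_cat -[RHS]add0n; congr (_ + _).
  apply/eqP; rewrite -leqn0 leqNgt -has_count; apply/hasPn => a.
  by rewrite mem_iota; lia.
rewrite -[RHS](size_iota (n.+1 - e t)); apply/eqP; rewrite -all_count.
by apply/allP => a; rewrite mem_iota; lia.
Qed.

End Conjugate.

(** * The code of a dissection *)

Section Dissection.
Variables (n m : nat).
Hypothesis m_gt0 : (0 < m)%N.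
Let M := m * n.+1.
Let N := M.+1.
Implicit Types (D : {set diag n m}) (G : seq (nat * nat)).

(* Left end of the interval left after removing [s] vertices from the polygon,
   alternately [m] from the right and [m] from the left; for [s = i * m] this
   interval is spanned by the diagonal of [-alpha_i]. *)
Fixpoint snake_left s := if s is s'.+1 then snake_left s' + odd (s' %/ m) else 0.

(** Time is reversed: removing [M - t] vertices from [[0, M.+1]] leaves an interval of length
    [t.+1]. *)
Definition snake_lo t := snake_left (M - t).

Lemma snake_left_blocks i k : k <= m ->
  snake_left (i * m + k) = i./2 * m + odd i * k.
Proof.
elim: i k => [|i IHi]; last first.
  have base : snake_left (i.+1 * m) = i.+1./2 * m.
    rewrite mulSn addnC (IHi m) // -mulnDl [i.+1./2]/= uphalf_half addnC.
    by rewrite addnC.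
  elim=> [|k IHk] km; first by rewrite addn0 base muln0 addn0.
  rewrite addnS /= IHk ?(ltnW km) // divnMDl // divn_small // addn0 /=.
  by case: (odd i) => /=; rewrite ?mul0n ?mul1n; lia.
by elim=> // k IHk km; rewrite addnS /= IHk ?(ltnW km) // divnMDl // divn_small.
Qed.

Lemma snake_left_leq s : snake_left s <= s.
Proof. by elim: s => //= s; case: (odd _) => /=; lia. Qed.

Lemma snake_schedule : schedule N snake_lo M.
Proof.
split=> t tM; last by have := snake_left_leq (M - t); rewrite /snake_lo /N; lia.
rewrite /snake_lo (_ : M - t = (M - t.+1).+1) /=; last by lia.
by case: (odd _); lia.
Qed.

Lemma snake_lo_last : snake_lo M = 0.
Proof. by rewrite /snake_lo subnn. Qed.

Lemma vertex_leq (x : 'I_(nverts n m)) : x <= N.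
Proof. by have := ltn_ord x; rewrite {2}/nverts addn2. Qed.

Definition diag_pair (d : diag n m) : nat * nat := (val d.1, val d.2).

Lemma diag_pair_inj : injective diag_pair.
Proof. by move=> [a b] [c d] [/val_inj-> /val_inj->]. Qed.

(* The outer edge is added, so that a dissection has one chord per cell. *)
Definition chords D := (0, N) :: [seq diag_pair d | d <- enum D].

Lemma outer_mchord : mchord m (0, N).
Proof.
rewrite /mchord /N /= ltnS muln_gt0 m_gt0 /=.
by rewrite -[M.+1]addn1 /M mulnC modnMDl.
Qed.

Lemma mod2_chord a b : a < b -> ((b - a).+1 == 2 %[mod m]) = (b == a.+1 %[mod m]).
Proof.
move=> ab; rewrite -(eqn_modDl a) addnS subnKC 1?ltnW // !addn2.
by rewrite -addn1 -(addn1 a.+1) eqn_modDr.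
Qed.

(** The polygon has [m * n.+1 + 2] vertices, which is 2 modulo [m], so the condition on one side of
    a diagonal implies the condition on the other side. *)
Lemma mod2_cochord a b : a < b -> b <= N -> b = a.+1 %[mod m] ->
  (nverts n m - (b - a)).+1 = 2 %[mod m].
Proof.
move=> ab bN /eqP; rewrite -mod2_chord // => ba; apply/eqP.
move: ba; rewrite -[2]/(1 + 1) -{1}addn1 eqn_modDr => /eqP ba.
rewrite -(eqn_modDl (b - a)) -addn1 addnA subnKC; last first.
  by rewrite /nverts -/M; lia.
by rewrite -[X in _ == X]modnDml ba modnDml /nverts mulnC -addnA modnMDl.
Qed.

Lemma mem_chords D d : (d \in D) -> diag_pair d \in chords D.
Proof. by move=> dD; rewrite inE map_f ?orbT // mem_enum. Qed.

Section Facet.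
Variable D : {set diag n m}.
Hypothesis diss : is_mdissection D.

Lemma outer_notin : (0, N) \notin [seq diag_pair d | d <- enum D].
Proof.
apply/mapP => -[d]; rewrite mem_enum => dD [d1 d2].
have [/(_ d dD)/and3P[/and3P[_ _ nouter] _ _] _ _] := diss; move: nouter.
by rewrite -d1 -d2 /nverts /N /M addn2 !eqxx.
Qed.

Lemma mem_chordsE d : (d \in D) = (diag_pair d \in chords D) && (diag_pair d != (0, N)).
Proof.
rewrite inE; case: eqVneq => [e|_] /=; last by rewrite andbT mem_map ?mem_enum //; exact: diag_pair_inj.
apply/negP => dD; move/negP: outer_notin; apply; rewrite -e.
by apply: map_f; rewrite mem_enum.
Qed.

Lemma chordsP d : d \in chords D -> mchord m d /\ inside 0 N d.
Proof.
rewrite inE => /orP[/eqP->|/mapP[e]].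
  by rewrite outer_mchord /inside /= leqnn.
rewrite mem_enum => eD ->; have [/(_ e eD)/and3P[/and3P[e12 e12' _] em _] _ _] := diss.
split; last by rewrite /inside /= vertex_leq.
by rewrite /mchord e12' -mod2_chord.
Qed.

Lemma chords_good : good m (chords D).
Proof.
have [dm _ nc] := diss; split.
- by rewrite /= outer_notin map_inj_uniq ?enum_uniq //; exact: diag_pair_inj.
- by move=> d /chordsP[].
move=> d e dG eG; have [_ di] := chordsP dG; have [_ ei] := chordsP eG.
move: dG eG; rewrite !inE => /orP[/eqP->|/mapP[d']].
  by move=> _; move: ei; rewrite /inside /=; lia.
rewrite mem_enum => dD ->; case/orP => [/eqP->|/mapP[e']]; first by rewrite ltn0.
by rewrite mem_enum => eD ->; have := nc _ _ dD eD; rewrite /cross negb_or => /andP[].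
Qed.

Lemma chords_inside : {in chords D, forall d, inside 0 N d}.
Proof. by move=> d /chordsP[]. Qed.

Lemma chords_bounded : bounded N (chords D).
Proof. by move=> d /chords_inside/andP[]. Qed.

Lemma size_chords : size (chords D) = n.+1.
Proof. by rewrite /= size_map -cardE; have [_ ->] := diss. Qed.

Lemma chords_tight : tight m (chords D) 0 N.
Proof.
by apply: full_tight chords_good chords_inside _ => //; rewrite size_chords.
Qed.

End Facet.

Definition facet_code D t := cnt (chords D) (snake_lo t) (snake_lo t + t.+1).

Lemma facet_code_coballot D : is_mdissection D -> coballot m n (facet_code D).
Proof.
move=> diss; have gG := chords_good diss.
(* The weight of the interval is at most [t + 2], and two of it are taken by the visible
   endpoints. *)
have B t : m * facet_code D t <= t.
  have lr : snake_lo t < snake_lo t + t.+1 by lia.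
  have := size_visible_ge2 (chords D) lr.
  have := weight_bound m_gt0 gG (ltnW lr).
  rewrite -/(facet_code D t); lia.
split.
- by have := B 0; rewrite leqn0 muln_eq0 => /orP[|]/eqP; lia.
- move=> t tM; apply: sub_count => d; rewrite /inside.
  by case: (snake_schedule) => /(_ t tM); lia.
- by move=> t _; exact: B.
rewrite -/M /facet_code snake_lo_last -[RHS](size_chords diss); apply/eqP.
by rewrite -all_count; apply/allP => d /(chords_inside diss).
Qed.

Lemma facet_code_inj D1 D2 : is_mdissection D1 -> is_mdissection D2 ->
  (forall t, t <= M -> facet_code D1 t = facet_code D2 t) -> D1 = D2.
Proof.
move=> d1 d2 ec; apply/setP => d; rewrite !mem_chordsE //; congr (_ && _).
have := chords_unique m_gt0 snake_schedule (chords_good d1) (chords_good d2)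
  (chords_bounded d1) (chords_bounded d2) (chords_tight d1) (chords_tight d2) ec.
by apply; rewrite snake_lo_last /inside /= vertex_leq.
Qed.

Lemma facet_code_surj e : coballot m n e ->
  exists2 D, is_mdissection D & forall t, t <= M -> facet_code D t = e t.
Proof.
move=> [e0 eS eB eM].
have [G [gG iG cG tG]] := chords_exist m_gt0 snake_schedule e0 eS eB.
rewrite snake_lo_last add0n -/N in iG tG.
have sG : size G = n.+1.
  rewrite -eM -cG // /cnt snake_lo_last add0n; apply/esym/eqP.
  by rewrite -all_count; apply/allP.
(* All [n.+1] chords lie in the whole interval, and [m * n.+1 + 1 = N] is the criterion for its two
   ends to be joined. Dropping this outer edge leaves the [n] diagonals of [D]. *)
have outG : (0, N) \in G.
  have c0N : cnt G 0 N = n.+1 by rewrite -eM -cG // snake_lo_last.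
  rewrite (mem_chord_tight m_gt0 gG _ tG) ?c0N ?subn0 ?eqxx //.
  by have /andP[] := outer_mchord.
have [uG mG ncG] := gG.
pose D := [set d : diag n m | (diag_pair d \in G) && (diag_pair d != (0, N))].
have pG : perm_eq ((0, N) :: [seq diag_pair d | d <- enum D]) G.
  apply: uniq_perm => //.
    rewrite /= map_inj_uniq ?enum_uniq ?andbT; last exact: diag_pair_inj.
    by apply/mapP => -[d]; rewrite mem_enum inE => /andP[_ /eqP nd] /esym.
  move=> x; rewrite inE; case: eqVneq => [->|nx] /=; first by rewrite outG.
  apply/mapP/idP => [[d]|xG]; first by rewrite mem_enum inE => /andP[dG _] ->.
  have := iG x xG; have := mG x xG; rewrite /mchord /inside => xm xi.
  have x2 : x.2 < nverts n m by rewrite /nverts addn2 ltnS; case/andP: xi.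
  have x1 : x.1 < nverts n m by case/andP: xm => x12 _; apply: ltn_trans x2; apply: ltnW.
  have ex : diag_pair (Ordinal x1, Ordinal x2) = x by rewrite /diag_pair /=; case: (x).
  by exists (Ordinal x1, Ordinal x2); rewrite ?mem_enum ?inE ex ?xG.
exists D; last first.
  by move=> t tM; rewrite -cG // /facet_code /cnt; apply/permP.
split.
- move=> d; rewrite inE => /andP[dG dN].
  have /andP[d12 dm] := mG _ dG; have /andP[_ dr] := iG _ dG.
  rewrite /= in d12 dm dr; have d12' := ltnW d12.
  apply/and3P; split.
  + rewrite /is_diagonal d12' d12 /=; apply: contra dN => /andP[/eqP d1 /eqP d2].
    by rewrite /diag_pair /= d1 d2 /nverts -/M addn2.
  + by rewrite mod2_chord.
  + by apply/eqP; apply: mod2_cochord => //; exact/eqP.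
- rewrite cardE -(size_map diag_pair); apply/eqP; rewrite -eqSS -sG.
  by rewrite -(perm_size pG).
move=> d d'; rewrite !inE => /andP[dG _] /andP[dG' _].
rewrite /cross negb_or (ncG _ _ dG dG') /=; exact: (ncG _ _ dG' dG).
Qed.

(** The diagonal of the negative simple root spans the snake interval at time [t = m * (n + 1 - i)],
    and [mem_chord_tight] says that it is present exactly when [m] times the code equals [t]. *)
Lemma contains_negsimple_code D i : is_mdissection D -> 1 <= i <= n ->
  contains_negsimple D i <-> facet_code D (M - i * m) = n.+1 - i.
Proof.
move=> diss /andP[i1 i_n].
set t := M - i * m.
have tE : t = m * (n.+1 - i) by rewrite /t /M mulnBr mulnC [i * m]mulnC [n.+1 * m]mulnC.
have imM : i * m <= M by rewrite mulnC leq_pmul2l // ltnW.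
have t0 : 0 < t by rewrite tE muln_gt0 m_gt0 subn_gt0.
have loE : snake_lo t = i./2 * m.
  by rewrite /snake_lo /t subKn // -[i * m]addn0 snake_left_blocks // muln0 addn0.
have im0 : 0 < i * m by rewrite muln_gt0 i1.
have hiE : snake_lo t + t.+1 = (n.+1 - uphalf i) * m + 1.
  have ui : uphalf i <= i by rewrite uphalf_half; have := odd_double_half i; lia.
  have uM : uphalf i * m <= i * m by rewrite leq_mul2r ui orbT.
  have iE : i * m = uphalf i * m + i./2 * m.
    by rewrite -mulnDl uphalf_half; congr (_ * m); have := odd_double_half i; lia.
  by rewrite loE mulnBl [n.+1 * m]mulnC -/M /t; lia.
have dE : negsimple_diag n m i = (snake_lo t, snake_lo t + t.+1).
  rewrite hiE loE /negsimple_diag /= uphalf_half.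
  by case: (odd i) => /=; rewrite ?add1n.
have tN : snake_lo t <= snake_lo t + t.+1 <= N.
  by case: snake_schedule => _ /(_ t (leq_subr _ _)); lia.
have tG := tight_inside m_gt0 (chords_good diss) (chords_bounded diss) (chords_tight diss) tN.
have lt : (snake_lo t).+1 < snake_lo t + t.+1 by lia.
have := mem_chord_tight m_gt0 (chords_good diss) lt tG.
rewrite -/(facet_code D t) addKn eqSS.
rewrite (_ : (_ == t) = (facet_code D t == n.+1 - i)); last first.
  by rewrite [X in _ == X]tE eqn_pmul2l.
move=> memE.
rewrite /contains_negsimple dE; split=> [[d dD dd]|ed].
  by apply/eqP; rewrite -memE -dd; exact: mem_chords.
have : (snake_lo t, snake_lo t + t.+1) \in chords D by rewrite memE ed.
(* The chord is not the added outer edge, since [t < M]. *)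
rewrite inE => /orP[/eqP[l0 r0]|/mapP[d]].
  by move: r0; rewrite l0 /N /t; lia.
by rewrite mem_enum => dD ->; exists d.
Qed.

End Dissection.

Import Order.TTheory GRing.Theory Num.Theory.
Import numFieldNormedType.Exports.
Local Open Scope classical_set_scope.
Local Open Scope ring_scope.

(** * The code of a configuration of points *)

(** The hypothesis makes the two sets comparable: an element of [P] outside [Q] forces [Q] into [P].
    Nested finite sets of equal size coincide. *)
Lemma eq_count_chain (T : eqType) (P Q : pred T) (s : seq T) :
  {in s &, forall p q, P p -> ~~ P q -> Q q -> Q p} ->
  count P s = count Q s -> {in s, P =1 Q}.
Proof.
move=> chain eqc.
have sub (P' Q' : pred T) : {in s, forall p, P' p -> Q' p} -> count P' s = count Q' s ->
    {in s, P' =1 Q'}.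
  move=> {chain eqc P Q}; elim: s => //= p s IHs sPQ eq.
  have le : (count P' s <= count Q' s)%N.
    have -> : count P' s = count (predI P' Q') s.
      apply: eq_in_count => q qs /=; case Pq: (P' q) => //=.
      by rewrite (sPQ q) // inE qs orbT.
    by apply: sub_count => q /andP[].
  have PQ := sPQ p (mem_head _ _).
  have [eqp eqs] : P' p = Q' p /\ count P' s = count Q' s.
    by move: PQ le eq; case: (P' p) => [->|] //; case: (Q' p) => //=; lia.
  move=> q; rewrite inE => /orP[/eqP->//|qs]; apply: IHs => // r rs.
  by apply: sPQ; rewrite inE rs orbT.
have [/allP sPQ|/allPn[p ps]] := boolP (all (fun p => P p ==> Q p) s).
  by apply: sub => // p ps; apply/implyP/sPQ.
rewrite negb_imply => /andP[Pp nQp] q qs; apply/esym.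
apply: (sub Q P) => // r rs Qr; apply: contraNT nQp => nPr.
exact: (chain p r).
Qed.

Section Points.
Variables (R : realFieldType) (m : nat).
Implicit Types (x y : nat -> R) (N : nat).

Definition generic N x := forall a b, (a < b)%N -> (b < N)%N ->
  0 < x a - x b /\ forall k, (k < m)%N -> x a - x b != k.+1%:R.

(** The pair [(a, k)] stands for the shifted point [x a - (k + 1)], so that [k] below [m] gives the
    shifts from 1 to [m]; shift 0 is settled by the order of the points. *)
Definition ahead x b (p : nat * nat) := p.2.+1%:R < x p.1 - x b.

Definition shifts b := [seq (a, k) | a <- iota 0 b, k <- iota 0 m].

Definition point_code x b := count (ahead x b) (shifts b).

Lemma mem_shifts b p : (p \in shifts b) = (p.1 < b)%N && (p.2 < m)%N.
Proof.
apply/allpairsP/andP => [[q]|[p1 p2]].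
  by rewrite !mem_iota !add0n => -[/andP[_ q1] /andP[_ q2] ->].
by exists p; rewrite !mem_iota !add0n; split => //; case: p {p1 p2}.
Qed.

Lemma size_shifts b : size (shifts b) = (m * b)%N.
Proof. by rewrite size_allpairs !size_iota mulnC. Qed.

Lemma shifts_uniq b : uniq (shifts b).
Proof. by apply: allpairs_uniq; rewrite ?iota_uniq // => -[a k] [a' k']. Qed.

Lemma shiftsD a b : shifts (a + b) = shifts a ++ [seq (c, k) | c <- iota a b, k <- iota 0 m].
Proof. by rewrite /shifts iotaD allpairs_cat. Qed.

Lemma point_code_leq x b : (point_code x b <= m * b)%N.
Proof. by rewrite -size_shifts count_size. Qed.

Lemma point_code_mono N x a b : generic N x -> (a <= b)%N -> (b < N)%N ->
  (point_code x a <= point_code x b)%N.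
Proof.
move=> gx ab bN; have [->//|nab] := eqVneq a b.
have ltab : (a < b)%N by rewrite ltn_neqAle nab.
have [xab _] := gx a b ltab bN.
rewrite /point_code -(subnKC ab) shiftsD count_cat; apply: leq_trans (leq_addr _ _).
by rewrite subnKC //; apply: sub_count => p; rewrite /ahead; lra.
Qed.

(** The smallest of the shifted points is [x b - m]; all of them exceed [x b.+1] as soon as this one
    does. *)
Lemma point_code_full N x b : (0 < m)%N -> generic N x -> (b.+1 < N)%N ->
  (point_code x b.+1 == m * b.+1)%N = (m%:R < x b - x b.+1).
Proof.
move=> m0 gx bN; rewrite -size_shifts -all_count; apply/allP/idP => [al|lt p].
  have := al (b, m.-1); rewrite mem_shifts /= leqnn prednK // leqnn => /(_ isT).
  by rewrite /ahead /= prednK.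
rewrite mem_shifts => /andP[p1 p2]; rewrite /ahead.
have le1 : p.2.+1%:R <= m%:R :> R by rewrite ler_nat.
have [->|npb] := eqVneq p.1 b; first exact: le_lt_trans lt.
have [||xp _] := gx p.1 b; try lia.
by move: lt le1 xp; lra.
Qed.

(** Comparing two shifted points means comparing [x a - x a'] with the integer [k - k'], whose
    absolute value is below [m]; the sign data and the order of the points decide this. *)
Lemma generic_compare N x y a a' k k' : generic N x -> generic N y ->
  (forall a b j, (a < b)%N -> (b < N)%N -> (j < m)%N ->
    (j.+1%:R < x a - x b) = (j.+1%:R < y a - y b)) ->
  (a < N)%N -> (a' < N)%N -> (k < m)%N -> (k' < m)%N ->
  (x a - k.+1%:R < x a' - k'.+1%:R) = (y a - k.+1%:R < y a' - k'.+1%:R).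
Proof.
move=> gx gy exy aN a'N km k'm.
have lt_case z (gz : generic N z) b b' j j' : (b < b')%N -> (b' < N)%N ->
    (j < m)%N -> (j' < m)%N ->
    (z b - j.+1%:R < z b' - j'.+1%:R) = (j' < j)%N && ~~ ((j - j').-1.+1%:R < z b - z b').
  move=> bb' b'N jm j'm; have [zb gb] := gz _ _ bb' b'N.
  have [le|lt] := leqP j j' => /=.
    have : j.+1%:R <= j'.+1%:R :> R by rewrite ler_nat.
    by move=> ?; apply/negbTE; rewrite -leNgt; lra.
  have -> : (j - j').-1.+1 = (j - j')%N by lia.
  have e : (j - j')%:R = j.+1%:R - j'.+1%:R :> R by rewrite -natrB ?subSS // ltnW.
  have := gb (j - j').-1; rewrite (_ : (j - j').-1.+1 = (j - j')%N); last by lia.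
  move=> /(_ ltac:(lia)); rewrite -leNgt e => ne.
  by rewrite le_eqVlt (negPf ne) /=; apply/idP/idP; lra.
have [lt|lt|->] := ltngtP a a'.
- by rewrite !lt_case // exy //; lia.
- rewrite !ltNge !le_eqVlt.
  have ne z : generic N z -> (z a' - k'.+1%:R == z a - k.+1%:R) = false.
    move=> gz; apply/eqP => e; have [zb gb] := gz _ _ lt aN.
    have e' : z a' - z a = k'.+1%:R - k.+1%:R by move: e; lra.
    have lk : (k < k')%N.
      rewrite ltnNge; apply/negP => le; have : k'.+1%:R <= k.+1%:R :> R by rewrite ler_nat.
      by lra.
    have := gb (k' - k).-1; rewrite prednK ?subn_gt0 // => /(_ ltac:(lia))/eqP.
    by apply; rewrite e' -natrB ?subSS // ltnW.
  by rewrite !ne // !lt_case // exy //; lia.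
by apply/idP/idP; lra.
Qed.

(* The values [x a - k] with [a < b] already placed are ordered in the same way
   for both configurations, and those exceeding [x b] form a final segment: it
   is determined by its cardinality. *)
Lemma point_code_inj N x y : generic N x -> generic N y ->
  (forall b, (b < N)%N -> point_code x b = point_code y b) ->
  forall a b j, (a < b)%N -> (b < N)%N -> (j < m)%N ->
    (j.+1%:R < x a - x b) = (j.+1%:R < y a - y b).
Proof.
elim: N => // N IHN gx gy ec a b j ab bN jm.
have gW z : generic N.+1 z -> generic N z.
  by move=> gz c d cd dN; apply: gz => //; lia.
have {}IHN := IHN (gW _ gx) (gW _ gy) (fun c cN => ec c (leqW cN)).
have [ltbN|leNb] := ltnP b N; first exact: IHN.
have eb : b = N by lia.
rewrite {b leNb bN}eb in ab *.
have := @eq_count_chain _ (ahead x N) (ahead y N) (shifts N) _ (ec N (ltnSn N)) (a, j).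
apply; last by rewrite mem_shifts ab.
move=> p q; rewrite !mem_shifts => /andP[p1 p2] /andP[q1 q2].
rewrite /ahead => xp xq yq.
have : x q.1 - q.2.+1%:R < x p.1 - p.2.+1%:R by move: xp xq; lra.
rewrite (generic_compare (gW _ gx) (gW _ gy) IHN) //.
by move: yq; lra.
Qed.

Lemma gap_below (Z : seq R) u : exists2 v, v < u & {in Z, forall z, z < u -> z < v}.
Proof.
elim: Z => [|z Z [v vu vZ]]; first by exists (u - 1) => //; lra.
have [zu|uz] := ltP z u; last first.
  exists v => // w; rewrite inE => /orP[/eqP->|wZ]; last exact: vZ.
  by rewrite ltNge uz.
exists (Num.max v ((z + u) / 2)); first by rewrite gt_max vu /=; lra.
move=> w; rewrite inE lt_max => /orP[/eqP->|wZ] wu; last by rewrite vZ.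
by apply/orP; right; lra.
Qed.

Lemma pred_below (Z : seq R) v : has (fun z => z < v) Z ->
  exists z, [/\ z \in Z, z < v & {in Z, forall w, w < v -> w <= z}].
Proof.
elim: Z => //= z Z IHZ.
have [/IHZ[w [wZ wv wmax]] _|nZ] := boolP (has (fun z => z < v) Z).
  have [zv|vz] := ltP z v; last first.
    exists w; split; rewrite ?inE ?wZ ?orbT // => t; rewrite inE => /orP[/eqP->|].
      by rewrite ltNge vz.
    exact: wmax.
  have [zw|wz] := leP z w.
    by exists w; split; rewrite ?inE ?wZ ?orbT // => t; rewrite inE => /orP[/eqP->|/wmax].
  exists z; split; rewrite ?inE ?eqxx // => t; rewrite inE => /orP[/eqP->//|tZ tv].
  by rewrite (le_trans (wmax _ tZ tv)) // ltW.
rewrite orbF => zv; exists z; split; rewrite ?inE ?eqxx // => t.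
by rewrite inE => /orP[/eqP->//|tZ tv]; case/hasP: nZ; exists t.
Qed.

(** Moving down from [u] past the elements of [Z] one at a time raises the count by 1 each time,
    until all of [Z] lies above. *)
Lemma choose_below (Z : seq R) u c : uniq Z -> u \notin Z ->
  (count (fun z => (u < z)%R) Z <= c <= size Z)%N ->
  exists v, [/\ v < u, v \notin Z & count (fun z => (v < z)%R) Z = c].
Proof.
move=> uZ nuZ /andP[/subnKC <-]; set c0 := count _ _.
have gapN w t : t < w -> {in Z, forall z, z < w -> z < t} -> t \notin Z.
  by move=> tw tZ; apply/negP => /tZ/(_ tw); rewrite ltxx.
elim: (c - c0)%N => [_|k IHk cZ].
  have [v vu vZ] := gap_below Z u; exists v; split=> //; first exact: gapN vZ.
  rewrite addn0; apply: eq_in_count => z zZ; apply/idP/idP => [vz|uz]; last exact: lt_trans uz.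
  rewrite ltNge le_eqVlt negb_or; apply/andP; split.
    by apply: contraNneq nuZ => <-.
  by apply/negP => /(vZ z zZ); rewrite ltNge ltW.
have [v [vu vZ cv]] : exists v, [/\ v < u, v \notin Z & count (fun z => (v < z)%R) Z = (c0 + k)%N].
  by apply: IHk; lia.
have : has (fun z => z < v) Z.
  rewrite -[has _ _]negbK -all_predC; apply: contraL cZ => /allP al.
  rewrite addnS -cv -leqNgt; apply/eq_leq/esym/eqP; rewrite -all_count.
  apply/allP => z zZ; have := al z zZ; rewrite /= -leNgt le_eqVlt.
  by case/orP=> // /eqP e; rewrite e zZ in vZ.
case/pred_below => z [zZ zv zmax].
have [w wz wZ] := gap_below Z z; exists w; split.
- exact: lt_trans wz (lt_trans zv vu).
- exact: gapN wZ.
(* The elements above [w] are those above [v] together with [z], which occurs once in [Z]. *)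
rewrite addnS -cv -addn1 -[1%N]/(nat_of_bool true) -zZ -count_uniq_mem //.
rewrite -count_predUI [X in (_ + X)%N](_ : _ = 0%N) ?addn0; last first.
  apply/eqP; rewrite -leqn0 leqNgt -has_count; apply/hasPn => t _ /=.
  by apply/negP => /andP[vt /eqP e]; move: vt; rewrite e ltNge ltW.
apply: eq_in_count => t tZ /=; apply/idP/orP => [wt|[vt|/eqP->//]].
  have [tv|vt] := ltP t v.
    right; rewrite eq_le zmax //= leNgt; apply/negP => /(wZ t tZ).
    by rewrite ltNge ltW.
  left; rewrite lt_neqAle vt andbT; by apply: contraNneq vZ => ->.
by rewrite (lt_trans wz) // (lt_trans zv).
Qed.

(** The points are placed one after the other. Just below the last point the number of shifted
    points above is the previous code, which is at most [c N]; moving further down reaches [c N]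
    exactly, away from the shifted points. *)
Lemma point_code_surj N (c : nat -> nat) :
  (forall a b, (a <= b)%N -> (b < N)%N -> (c a <= c b)%N) ->
  (forall a, (a < N)%N -> (c a <= m * a)%N) ->
  exists2 x, generic N x & forall b, (b < N)%N -> point_code x b = c b.
Proof.
elim: N => [|N IHN] cS cB; first by exists (fun=> 0).
have [||x gx cx] := IHN.
- by move=> a b ab bN; apply: cS => //; exact: leqW.
- by move=> a aN; apply: cB; exact: leqW.
pose Z := [seq x p.1 - p.2.+1%:R | p <- shifts N].
have sZ : size Z = (m * N)%N by rewrite size_map size_shifts.
have uZ : uniq Z.
  rewrite map_inj_in_uniq ?shifts_uniq // => -[a k] [b j].
  rewrite !mem_shifts /= => /andP[aN km] /andP[bN jm] e.
  have ne a' b' k' j' : (a' < b')%N -> (b' < N)%N -> (k' < m)%N -> (j' < m)%N ->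
      x a' - k'.+1%:R != x b' - j'.+1%:R.
    move=> lt bN' km' jm'; apply/eqP => e'; have [xp xn] := gx _ _ lt bN'.
    have lk : (j' < k')%N.
      rewrite ltnNge; apply/negP => le; have : k'.+1%:R <= j'.+1%:R :> R by rewrite ler_nat.
      by move: e' xp; lra.
    have := xn (k' - j').-1; rewrite prednK ?subn_gt0 // => /(_ ltac:(lia))/eqP.
    by apply; rewrite -subSS natrB ?ltnS 1?ltnW //; move: e'; lra.
  have [ab|ba|ab] := ltngtP a b.
  - by have := ne a b k j ab bN km jm; rewrite e eqxx.
  - by have := ne b a j k ba aN jm km; rewrite e eqxx.
  have /eqP : k.+1%:R = j.+1%:R :> R by move: e; rewrite ab; lra.
  by rewrite eqr_nat ab => /eqP[->].
have code_count v : (count (fun z => (v < z)%R) Z = count (fun p => (p.2.+1%:R < x p.1 - v)%R) (shifts N))%N.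
  by rewrite count_map; apply: eq_count => p /=; apply/idP/idP; lra.
have [v [vlt vZ cv]] : exists v, [/\ (forall a, (a < N)%N -> v < x a), v \notin Z &
    count (fun z => (v < z)%R) Z = c N].
  have cN : (c N <= size Z)%N by rewrite sZ cB.
  (* Without an earlier point there is no constraint and the first one is put at 0. *)
  case: N IHN cS cB gx cx @Z sZ uZ code_count cN => [|N] IHN cS cB gx cx Z sZ uZ code_count cN.
    have Z0 : Z = [::] by apply/size0nil; rewrite sZ muln0.
    by exists 0; split=> //; rewrite Z0 //=; move: cN; rewrite sZ muln0 leqn0 => /eqP.
  have [||v [vx vZ cv]] := @choose_below Z (x N) (c N.+1) uZ.
  - apply/mapP => -[p]; rewrite mem_shifts ltnS leq_eqVlt => /andP[/orP[/eqP->|p1] p2].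
      have : 0 < p.2.+1%:R :> R by rewrite ltr0n.
      by lra.
    have [_ /(_ _ p2)/eqP ne] := gx _ _ p1 (ltnSn N).
    by move=> e; apply: ne; move: e; lra.
  - rewrite cN andbT code_count -[in shifts _]addn1 shiftsD count_cat.
    rewrite [X in (_ + X)%N](_ : _ = 0%N) ?addn0.
      by rewrite -[count _ _]/(point_code x N) cx // cS.
    apply/eqP; rewrite -leqn0 leqNgt -has_count; apply/hasPn => p.
    case/allpairsP => q [/=]; rewrite inE => /eqP q1 _ ->; rewrite /= q1 subrr.
    by rewrite -leNgt ler0n.
  exists v; split=> // a; rewrite ltnS leq_eqVlt => /orP[/eqP->//|aN].
  by have [xa _] := gx _ _ aN (ltnSn N); move: vx xa; lra.
pose y a := if (a < N)%N then x a else v.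
have yx a : (a < N)%N -> y a = x a by rewrite /y => ->.
have yN : y N = v by rewrite /y ltnn.
exists y => [a b ab|b]; rewrite ltnS leq_eqVlt.
  case/orP=> [/eqP eb|bN]; last by rewrite !yx //; [exact: gx|exact: ltn_trans bN].
  rewrite {b}eb in ab *; have aN := ab; rewrite yx // yN; split=> [|k km]; first by rewrite subr_gt0 vlt.
  apply: contraNneq vZ => e; apply/mapP; exists (a, k); first by rewrite mem_shifts aN.
  by rewrite /=; lra.
case/orP=> [/eqP->|bN].
  rewrite -cv code_count; apply: eq_in_count => p; rewrite mem_shifts => /andP[p1 _].
  by rewrite /ahead yN yx.
rewrite -cx //; apply: eq_in_count => p; rewrite mem_shifts => /andP[p1 _].
by rewrite /ahead !yx // (ltn_trans p1).
Qed.

End Points.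

(** * Dominant regions *)

Section Regions.
Variables (R : realType) (n m : nat).
Implicit Types (v w x : vec R n).

Lemma dotv_eroot v (a b : 'I_n.+1) : dotv v (eroot R a b) = v 0 a - v 0 b.
Proof.
have dd c : \sum_(k < n.+1) v 0 k * (k == c)%:R = v 0 c.
  rewrite (bigD1 c) //= eqxx mulr1 big1 ?addr0 // => k /negPf->.
  by rewrite mulr0.
rewrite /dotv -(dd a) -(dd b) -sumrB; apply: eq_bigr => k _.
by rewrite mxE mulrBr.
Qed.

Lemma cat_complementP v : cat_complement m v <-> Vsp v /\
  forall a b : 'I_n.+1, (a < b)%N -> forall j, (j <= m)%N -> v 0 a - v 0 b != j%:R.
Proof.
split=> -[Vv cv]; split=> //.
  move=> a b ab j jm; apply/eqP => e; apply: cv; exists (eroot R a b), j%:R.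
  by split; [split; [exists a, b|exists j]|rewrite dotv_eroot].
move=> [_ [_ [[[a [b [ab ->]]] [j [jm ->]]]]]]; rewrite dotv_eroot => e.
by have := cv a b ab j jm; rewrite e eqxx.
Qed.

Definition same_side v w := forall a b : 'I_n.+1, (a < b)%N ->
  forall j, (j <= m)%N ->
  (j%:R < v 0 a - v 0 b /\ j%:R < w 0 a - w 0 b) \/
  (v 0 a - v 0 b < j%:R /\ w 0 a - w 0 b < j%:R).

Lemma continuous_coordB (a b : 'I_n.+1) : continuous (fun v => v 0 a - v 0 b).
Proof.
move=> v; have h c := @coord_continuous R 1 n.+1 0 c v.
exact: (cvgB (h a) (h b)).
Qed.

Lemma convex_gt (t c y z : R) : 0 <= t <= 1 -> c < y -> c < z ->
  c < (1 - t) * y + t * z.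
Proof.
case/andP=> t0 t1 cy cz; have [->|nt] := eqVneq t 0; first by lra.
have tz : 0 < t * (z - c) by rewrite mulr_gt0 ?subr_gt0 // lt_neqAle eq_sym nt.
have : 0 <= (1 - t) * (y - c) by rewrite mulr_ge0 ?subr_ge0 // ltW.
by lra.
Qed.

(** On a connected subset of the complement each coordinate difference takes values in an interval
    avoiding [0, ..., m], so the sides are constant. Conversely the segment between two points on
    the same sides stays in the complement. *)
Lemma region_sides x w : cat_complement m x ->
  connected_component (cat_complement m) x w <-> Vsp w /\ same_side x w.
Proof.
move=> cx; have [Vx nx] := (cat_complementP x).1 cx.
split=> [[A [Ax Asub Ac] Aw]|[Vw sxw]].
  have cw := Asub _ Aw; have [Vw nw] := (cat_complementP w).1 cw.
  split=> // a b ab j jm.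
  have iA : is_interval ((fun v => v 0 a - v 0 b) @` A).
    apply/connected_intervalP/connected_continuous_connected => //.
    exact/continuous_subspaceT/continuous_coordB.
  have jA : ~ ((fun v => v 0 a - v 0 b) @` A) j%:R.
    move=> [v Av ev]; have [_ nv] := (cat_complementP v).1 (Asub _ Av).
    by have := nv a b ab j jm; rewrite ev eqxx.
  have xA : ((fun v => v 0 a - v 0 b) @` A) (x 0 a - x 0 b) by exists x.
  have wA : ((fun v => v 0 a - v 0 b) @` A) (w 0 a - w 0 b) by exists w.
  have := nx a b ab j jm; have := nw a b ab j jm; rewrite !neq_lt.
  case/orP=> wj /orP[] xj; [by right| | |by left]; exfalso; apply: jA.
    by apply: (iA _ _ wA xA); rewrite !ltW.
  by apply: (iA _ _ xA wA); rewrite !ltW.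
exists ((fun t : R => x + t *: (w - x)) @` `[0, 1]); last first.
  by exists 1; rewrite ?scale1r ?subrKC //= in_itv /= lexx ler01.
split.
- by exists 0; rewrite ?scale0r ?addr0 //= in_itv /= lexx ler01.
- move=> _ [t /= + <-]; rewrite in_itv /= => /andP[t0 t1]; apply/cat_complementP; split.
    rewrite /Vsp /=; under eq_bigr do rewrite !mxE.
    rewrite big_split /= -mulr_sumr big_split /= sumrN.
    by move: Vx Vw; rewrite /Vsp /= => -> ->; rewrite subrr mulr0 addr0.
  move=> a b ab j jm; rewrite !mxE.
  have -> : x 0 a + t * (w 0 a - x 0 a) - (x 0 b + t * (w 0 b - x 0 b)) =
    (1 - t) * (x 0 a - x 0 b) + t * (w 0 a - w 0 b) by ring.
  have [[xj wj]|[xj wj]] := sxw a b ab j jm; rewrite neq_lt; apply/orP.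
    by right; apply: convex_gt => //; rewrite t0.
  left; rewrite -ltrN2 opprD -!mulrN; apply: convex_gt; rewrite ?t0 ?ltrN2 //.
apply: connected_continuous_connected; first exact: segment_connected.
apply: continuous_subspaceT => t; apply: cvgD; first exact: cvg_cst.
exact: scalel_continuous.
Qed.

Definition decreasing v := forall a b : 'I_n.+1, (a < b)%N -> v 0 b < v 0 a.

Definition entry v (a : nat) : R := v 0 (inord a).

Lemma inord_lt a b : (a < b)%N -> (b < n.+1)%N ->
  ((inord a : 'I_n.+1) < (inord b : 'I_n.+1))%N.
Proof. by move=> ab bn; rewrite !inordK // (ltn_trans ab). Qed.

Lemma entry_generic v : cat_complement m v -> decreasing v -> generic m n.+1 (entry v).
Proof.
move=> /cat_complementP[_ cv] dv a b ab bn; have abo := inord_lt ab bn.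
by split=> [|k km]; [rewrite subr_gt0 dv|exact: cv].
Qed.

Lemma code_ballot v : cat_complement m v -> decreasing v ->
  ballot m n (point_code m (entry v)).
Proof.
move=> cv dv; have gv := entry_generic cv dv; split=> [a b ab bn|a _].
  exact: point_code_mono gv ab _.
exact: point_code_leq.
Qed.

(** The hyperplanes with [k = 0] are handled by monotonicity of the coordinates, those with [k] from
    1 to [m] by the point code. *)
Lemma same_sideP v w : cat_complement m v -> decreasing v ->
  cat_complement m w ->
  same_side v w <-> decreasing w /\
    forall b, (b < n.+1)%N -> point_code m (entry v) b = point_code m (entry w) b.
Proof.
move=> cv dv cw; split=> [svw|[dw ec]].
  split=> [a b ab|b bn].
    have := dv a b ab; have := svw a b ab 0%N isT.
    by case=> -[]; lra.
  apply: eq_in_count => p; rewrite mem_shifts => /andP[pb pm].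
  rewrite /ahead /entry; have := svw _ _ (inord_lt pb bn) p.2.+1 pm.
  by case=> -[h1 h2]; apply/idP/idP; lra.
have same := point_code_inj (entry_generic cv dv) (entry_generic cw dw) ec.
have [_ nv] := (cat_complementP v).1 cv; have [_ nw] := (cat_complementP w).1 cw.
move=> a b ab [_|j jm]; first by left; rewrite !subr_gt0 dv // dw.
have := same a b j ab (ltn_ord b) jm; rewrite /entry !inord_val.
have := nv a b ab j.+1 jm; have := nw a b ab j.+1 jm; rewrite !neq_lt.
by case: ltgtP => // ? _; case: ltgtP => // ? _ ?; [right|left].
Qed.

(** Defining the region by its code, not as the component of a chosen point, makes it a function of
    [e] with no choice involved. *)
Definition code_region (e : nat -> nat) : set (vec R n) :=
  [set v | [/\ cat_complement m v, decreasing v &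
    forall t, (t <= m * n.+1)%N -> conjugate m n (point_code m (entry v)) t = e t]].

Lemma code_region_component e v : (0 < m)%N -> code_region e v ->
  code_region e = connected_component (cat_complement m) v.
Proof.
move=> m0 [cv dv ev]; apply/seteqP; split=> w.
  move=> [cw dw ew]; apply/(region_sides w cv).
  split; first by have [] := (cat_complementP w).1 cw.
  apply/(same_sideP cv dv cw); split=> // b bn.
  apply: (conjugate_inj m0 (code_ballot cv dv) (code_ballot cw dw)) => //.
  by move=> t tM; rewrite ev // ew.
move=> vw; have cw := connected_component_sub vw.
have [Vw sw] := (region_sides w cv).1 vw.
have [dw ew] := (same_sideP cv dv cw).1 sw; split=> // t tM; rewrite -ev //.
by apply: eq_in_count => a; rewrite mem_iota add0n => /andP[_ an]; rewrite ew.
Qed.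

Lemma code_region_nonempty e : (0 < m)%N -> coballot m n e -> exists v, code_region e v.
Proof.
move=> m0 /(conjugate_surj m0)[c [cS cB] ce].
have [||x gx cx] := @point_code_surj R m n.+1 c; [by move=> a b ab bn; exact: cS|by move=> a an; exact: cB|].
(* Subtracting the mean brings the configuration into the hyperplane of sum zero without changing
   any difference. *)
pose s := (\sum_(k < n.+1) x k) / n.+1%:R.
pose v : vec R n := \row_(k < n.+1) (x k - s).
have vE a : (a < n.+1)%N -> entry v a = x a - s by move=> an; rewrite /entry mxE inordK.
have vB (a b : 'I_n.+1) : v 0 a - v 0 b = x a - x b by rewrite !mxE; ring.
exists v; split.
- apply/cat_complementP; split.
    rewrite /Vsp /=; under eq_bigr do rewrite mxE.
    rewrite sumrB sumr_const card_ord /s -[_ *+ n.+1]mulr_natr divfK ?subrr //.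
  move=> a b ab [|j] jm; rewrite vB; have [xp xn] := gx a b ab (ltn_ord b).
    by rewrite gt_eqF.
  exact: xn.
- by move=> a b ab; have [xp _] := gx a b ab (ltn_ord b); rewrite -subr_gt0 vB.
move=> t tM; rewrite -ce //; apply: eq_in_count => a; rewrite mem_iota add0n => /andP[_ an].
rewrite -cx //; congr (_ <= _ + _)%N; apply: eq_in_count => p.
rewrite mem_shifts => /andP[pa _]; rewrite /ahead !vE ?(ltn_trans pa) //.
by rewrite (_ : x p.1 - s - (x a - s) = x p.1 - x a) //; ring.
Qed.

Lemma code_region_dominant e : (0 < m)%N -> coballot m n e ->
  is_dominant_region m (code_region e).
Proof.
move=> m0 ce; have [v ev] := code_region_nonempty m0 ce; split.
  by exists v; split; [case: ev|exact: code_region_component].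
move=> w [cw dw _]; split; first by case: cw.
by move=> _ [a [b [ab ->]]]; rewrite dotv_eroot subr_ge0 ltW // dw.
Qed.

(** Points of the complement avoid the hyperplanes with [k = 0], so the weak inequalities of the
    dominant chamber become strict. *)
Lemma dominant_regionP Rg : is_dominant_region m Rg ->
  exists x, [/\ cat_complement m x, decreasing x &
    Rg = connected_component (cat_complement m) x].
Proof.
move=> [[x [cx ->]] dom]; exists x; split=> // a b ab.
have [_ /(_ (eroot R a b))] := dom _ (connected_component_refl cx).
have [_ nx] := (cat_complementP x).1 cx; have := nx a b ab 0%N isT.
rewrite dotv_eroot => ne pos; rewrite -subr_gt0 lt_neqAle eq_sym ne pos //.
by exists a, b.
Qed.

End Regions.

(** * Separating walls for simple roots *)

Section Walls.
Variables (R : realType) (n m i : nat).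
Hypothesis i_range : (1 <= i <= n)%N.
Implicit Types (v w x p q : vec R n).

(** The positive roots whose expansion in simple roots contains the [i]-th one. *)
Definition split_by (a b : 'I_n.+1) := (a < i <= b)%N.

(** This is [n + 1] times the [i]-th fundamental coweight: it pairs to [n + 1] with the roots
    containing the [i]-th simple root and to 0 with the other positive roots. *)
Definition push : vec R n := \row_(k < n.+1) (if (k < i)%N then (n.+1 - i)%:R else - i%:R).

Lemma push_Vsp : Vsp push.
Proof.
rewrite /Vsp /=; under eq_bigr do rewrite mxE.
have [i0 i_n] : (0 < i)%N /\ (i <= n.+1)%N by lia.
rewrite -(big_mkord xpredT (fun k => if (k < i)%N then (n.+1 - i)%:R else - i%:R : R)).
rewrite (big_cat_nat (n := i)) //=.
rewrite (eq_big_nat _ _ (F2 := fun=> (n.+1 - i)%:R)); last by move=> k /andP[_ ->].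
rewrite [X in _ + X](eq_big_nat _ _ (F2 := fun=> - i%:R)); last first.
  by move=> k /andP[ik _]; rewrite ltnNge ik.
rewrite !big_const_nat !iter_addr !addr0 subn0 mulNrn -!mulrnA mulnC.
by rewrite subrr.
Qed.

Lemma pushB (a b : 'I_n.+1) : (a < b)%N ->
  push 0 a - push 0 b = if split_by a b then n.+1%:R else 0.
Proof.
move=> ab; rewrite !mxE /split_by; case: (ltnP a i) => /= ai; last first.
  by rewrite ltnNge (leq_trans ai (ltnW ab)) /= subrr.
case: (leqP i b) => ib; last by rewrite subrr.
by rewrite opprK -natrD subnK //; lia.
Qed.

Lemma separating_wallP v : cat_complement m v -> decreasing v -> (0 < m)%N ->
  is_separating_wall m (connected_component (cat_complement m) v)
    (simple_root R n i) m%:R <->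
  m%:R < entry v i.-1 - entry v i.
Proof.
move=> cv dv m0; have [Vv nv] := (cat_complementP m v).1 cv.
have i1n : (i.-1 < i)%N && (i < n.+1)%N by lia.
have [i1 i_n] := andP i1n; have io := inord_lt i1 i_n.
have dot0 : dotv 0 (simple_root R n i) = 0 by rewrite dotv_eroot !mxE subrr.
split=> [[_ [[/(_ v)]|[_]]]|lt].
- by move=> /(_ (connected_component_refl cv)); rewrite dotv_eroot.
- by rewrite dot0 ltrn0.
(* Among the roots split by [i], the simple one has the smallest value on a decreasing vector. *)
have cross a b : split_by a b -> m%:R < v 0 a - v 0 b.
  move=> /andP[ai ib]; move: lt; rewrite /entry.
  have le1 : v 0 (inord i.-1) <= v 0 a.
    have [lt1|ge1] := ltnP a i.-1; first by apply/ltW/dv; rewrite inordK //; lia.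
    by have -> // : a = inord i.-1; apply: val_inj; rewrite /= inordK; lia.
  have le2 : v 0 b <= v 0 (inord i).
    have [lt2|ge2] := ltnP i b; first by apply/ltW/dv; rewrite inordK.
    by have -> // : b = inord i; apply: val_inj; rewrite /= inordK; lia.
  by move=> ?; lra.
(* The multiple of [push] to subtract so that [p] lies on the hyperplane; the values of [v] on roots
   not split by [i] are unchanged. *)
pose g := (entry v i.-1 - entry v i - m%:R) / n.+1%:R.
pose p : vec R n := v - g *: push.
have pE a : p 0 a = v 0 a - g * push 0 a by rewrite /p !mxE.
have pB (a b : 'I_n.+1) : (a < b)%N -> p 0 a - p 0 b =
    v 0 a - v 0 b - (if split_by a b then entry v i.-1 - entry v i - m%:R else 0).
  move=> ab; rewrite !pE (_ : _ - _ = v 0 a - v 0 b - g * (push 0 a - push 0 b)); last by ring.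
  by rewrite pushB //; case: ifP => _; rewrite ?mulr0 // divfK // pnatr_eq0.
(* The strict inequalities for non-split roots hold at [p], hence near [p]. Taking [j] in a finite
   type lets finitely many neighbourhoods be intersected. *)
pose keeps (a b : 'I_n.+1) (j : 'I_m.+1) q := (a < b)%N -> ~~ split_by a b ->
    (j%:R < v 0 a - v 0 b /\ j%:R < q 0 a - q 0 b) \/
    (v 0 a - v 0 b < j%:R /\ q 0 a - q 0 b < j%:R).
have near_keeps a b j : nbhs p (keeps a b j).
  have [ab|nab] := boolP ((a < b)%N && ~~ split_by a b); last first.
    by apply: filterE => q ab ns; rewrite ab ns in nab.
  have [ab1 ns] := andP ab; have pab := pB a b ab1; rewrite (negPf ns) subr0 in pab.
  have := nv a b ab1 j (ltn_ord j); rewrite neq_lt => /orP[vj|vj].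
    have := cvgr_lt _ (@continuous_coordB R n a b p); rewrite /= pab => /(_ _ _ vj).
    by apply: filterS => q ? _ _; right.
  have := cvgr_gt _ (@continuous_coordB R n a b p); rewrite /= pab => /(_ _ _ vj).
  by apply: filterS => q ? _ _; left.
have near_p : nbhs p [set q | forall a b j, keeps a b j q].
  apply: (@filter_forall _ _ (fun a q => forall b j, keeps a b j q) (nbhs p)) => a.
  apply: (@filter_forall _ _ (fun b q => forall j, keeps a b j q) (nbhs p)) => b.
  by apply: (@filter_forall _ _ (keeps a b) (nbhs p)) => j; exact: near_keeps.
split; last first.
  left; split=> [w /(region_sides w cv)[_ sw]|]; last by rewrite dot0 ltr0n.
  rewrite dotv_eroot; have := sw _ _ io m (leqnn m).
  by move: lt; rewrite /entry => ? [[]|[]]; lra.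
split.
  split; last by exists m.
  by exists (inord i.-1), (inord i).
exists p; split.
  split; last first.
    have sp : split_by (inord i.-1) (inord i).
      by rewrite /split_by !inordK //; lia.
    by rewrite dotv_eroot pB // sp /entry; lra.
  have := push_Vsp; move: Vv; rewrite /Vsp /= => Vv Vp.
  under eq_bigr do rewrite pE.
  by rewrite sumrB -mulr_sumr Vv Vp mulr0 subrr.
have [e e0 pe] := (nbhs_ballP _ _).1 near_p.
exists e => // q [Vq qm] /pe near_q B nB.
(* A point [q] of the hyperplane near [p] is in the closure because a small positive multiple of
   [push] leads from [q] into the region. *)
have [t t0 Bt] : exists2 t : R, 0 < t & B (q + t *: push).
  have cq : (fun t : R => q + t *: push) @ (0 : R) --> q + 0 *: push.
    by apply: cvgD; [exact: cvg_cst|exact: scalel_continuous].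
  rewrite scale0r addr0 in cq.
  have [d /= d0 dB] := (nbhs_ballP _ _).1 (cq _ nB).
  exists (d / 2); first by rewrite divr_gt0.
  apply: dB; rewrite /ball /= sub0r normrN gtr0_norm ?divr_gt0 //.
  by rewrite ltr_pdivrMr // mulr_natr mulr2n ltrDl.
have wE c : (q + t *: push) 0 c = q 0 c + t * push 0 c by rewrite !mxE.
exists (q + t *: push); split=> //; apply/(region_sides _ cv); split.
  have := push_Vsp; move: Vq; rewrite /Vsp /= => Vq Vp.
  under eq_bigr do rewrite wE.
  by rewrite big_split /= -mulr_sumr Vq Vp mulr0 addr0.
have wB (a b : 'I_n.+1) : (a < b)%N -> (q + t *: push) 0 a - (q + t *: push) 0 b =
    q 0 a - q 0 b + (if split_by a b then t * n.+1%:R else 0).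
  move=> ab; rewrite !wE (_ : _ - _ = q 0 a - q 0 b + t * (push 0 a - push 0 b)); last by ring.
  by rewrite pushB //; case: ifP => _; rewrite ?mulr0.
move=> a b ab j jm; rewrite wB //; case: ifPn => ns; last first.
  by rewrite addr0; exact: (near_q a b (Ordinal (jm : (j < m.+1)%N))).
(* For a split root the value at [q] is at least that of the simple root, which is [m], and the push
   adds a positive amount. *)
left; have jm' : j%:R <= m%:R :> R by rewrite ler_nat.
split; first exact: le_lt_trans (cross a b ns).
have qdec (c d : 'I_n.+1) : (c < d)%N -> ~~ split_by c d -> q 0 d < q 0 c.
  move=> cd ncd; have vcd := dv c d cd.
  have [[_]|[]] := near_q c d ord0 cd ncd; first by rewrite subr_gt0.
  by rewrite subr_lt0 ltNge ltW.
have [ai ib] := andP ns.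
have le1 : q 0 (inord i.-1) <= q 0 a.
  have [lt1|] := ltnP a i.-1.
    by apply/ltW/qdec; rewrite /split_by inordK //; lia.
  move=> ge1; have -> // : a = inord i.-1 by apply: val_inj; rewrite /= inordK; lia.
have le2 : q 0 b <= q 0 (inord i).
  have [lt2|] := ltnP i b.
    by apply/ltW/qdec; rewrite /split_by inordK //; lia.
  move=> ge2; have -> // : b = inord i by apply: val_inj; rewrite /= inordK; lia.
have tn : 0 < t * n.+1%:R by rewrite mulr_gt0.
by move: qm; rewrite dotv_eroot; lra.
Qed.

End Walls.

(** * The bijection between dissections and dominant regions *)

Theorem theorem1p1 (R : realType) (n m : nat) :
  (0 < n)%N -> (0 < m)%N ->
  exists omega : {set diag n m} -> set (vec R n),
    [/\ (forall D, is_mdissection D -> is_dominant_region m (omega D)),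
        (forall D1 D2, is_mdissection D1 -> is_mdissection D2 ->
           omega D1 = omega D2 -> D1 = D2),
        (forall Rg, is_dominant_region m Rg ->
           exists2 D, is_mdissection D & omega D = Rg) &
        (forall (i : nat) (D : {set diag n m}), (1 <= i <= n)%N ->
           is_mdissection D ->
           (contains_negsimple D i <->
            is_separating_wall m (omega D) (simple_root R n i) (m%:R)))].
Proof.
move=> _ m0; exists (fun D => @code_region R n m (facet_code D)); split.
- by move=> D dD; apply: code_region_dominant => //; exact: facet_code_coballot.
- move=> D1 D2 d1 d2 eD; apply: facet_code_inj => // t tM.
  (* A common point of the two equal regions recovers both codes. *)
  have [v vD1] := code_region_nonempty R m0 (facet_code_coballot m0 d1).
  have := vD1; rewrite eD => -[_ _ <-] //.
  by case: vD1 => _ _ <-.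
- move=> Rg /dominant_regionP[x [cx dx ->]].
  have [D dD eD] := facet_code_surj m0 (conjugate_coballot m0 (code_ballot cx dx)).
  by exists D => //; apply: code_region_component => //; split=> // t tM; rewrite eD.
move=> i D iR dD; have cD := facet_code_coballot m0 dD.
have [v vD] := code_region_nonempty R m0 cD; have [cv dv ev] := vD.
rewrite (code_region_component m0 vD); have bv := code_ballot cv dv.
apply: iff_trans (contains_negsimple_code m0 dD iR) _.
apply: iff_trans; last by apply: iff_sym; exact: separating_wallP.
have [i1 i_n] := andP iR; set t := (m * n.+1 - i * m)%N.
have tM : (t <= m * n.+1)%N by exact: leq_subr.
have imM : (i * m <= m * n.+1)%N by rewrite mulnC leq_pmul2l //; lia.
have lei : (facet_code D t <= n.+1 - i)%N.
  rewrite -(leq_pmul2l m0); have [_ _ /(_ t tM) le _] := cD.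
  by apply: leq_trans le _; rewrite mulnBr /t mulnC [(i * m)%N]mulnC mulnC.
(* Conjugation at [a = i] and [t = m * (n + 1 - i)]: the count exceeds [n - i] exactly when the
   point code at [i] is at least [m * i], and both quantities are then at their maximum. *)
have fullE : (facet_code D t == n.+1 - i)%N = (point_code m (entry v) i == m * i)%N.
  have := conjugate_lt m0 t bv i_n; rewrite ev // => E.
  rewrite eqn_leq lei subSn // E [RHS]eqn_leq point_code_leq /= mulnC /t.
  by apply/idP/idP; lia.
have := @point_code_full R m n.+1 (entry v) i.-1 m0 (entry_generic cv dv).
by rewrite prednK // ltnS -fullE => /(_ i_n) <-; split=> /eqP.
Qed.
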